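(* Let $$\Sigma=\{x\in\mathbb R^d: D_ix+d_i\in\mathcal L_{n_i}\ (1\le i\le\nu),\ Ex=f\}$$ be an affine second-order cone feasibility system with arbitrary real data $D_i,d_i,E,f$. Let $C$, $B$, $H_\Sigma$ be its homogenization and $\mathfrak N(\Sigma)$ the affine second-order cone feasibility system constructed from them, all as defined in the context. Then $\mathfrak N(\Sigma)$ is a second-order cone system of polynomial size (in the size of $\Sigma$) that is feasible if and only if $$h_\tau=0\qquad\text{for every }h\in H_\Sigma,$$ equivalently, if and only if $\Sigma$ is infeasible (i.e. $\Sigma=\varnothing$). The transformation $\Sigma\mapsto\mathfrak N(\Sigma)$ applies to arbitrary real input data and uses only fixed rational constants in addition to those data.
   Context: For $k\ge2$, $\mathcal L_k=\{(t,z)\in\mathbb R\times\mathbb R^{k-1}: t\ge\|z\|_2\}$ is the Lorentz cone. The rank is defined by $\operatorname{rank}\mathcal L_k=2$, $\operatorname{rank}\mathbb R_+=1$, and is additive over products. Homogenization. Write $x=x^+-x^-$ with $x^\pm\in\mathbb R_+^d$, and put $$h=(\tau,x^+,x^-,s_1,\dots,s_\nu)\in C:=\mathbb R_+\times\mathbb R_+^d\times\mathbb R_+^d\times\prod_{i=1}^\nu\mathcal L_{n_i},$$ with $h_\tau=\tau$ the first coordinate and $e_\tau$ the corresponding coordinate vector. The homogeneous equations are $s_i=D_i(x^+-x^-)+\tau d_i$ $(1\le i\le \nu)$ and $E(x^+-x^-)=\tau f$; let $B$ be the matrix collecting them, so that they read $Bh=0$. Set $H_\Sigma=\ker B\cap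 C$. Fixed maps and the mapping $\operatorname{tan}'$. Write $C=\prod_i C_i$ as a product of blocks, each $\mathbb R_+$ or a Lorentz cone. For $C_i=\mathcal L_k$, index coordinates by $0,\dots,k-1$, with coordinate vectors $e_a$, set $J=\operatorname{diag}(1,-1,\dots,-1)$, $S_{ab}=e_ae_b^T-e_be_a^T$, and $\mathcal R_i=\{I_k\}\cup\{S_{ab}J:0\le a<b<k\}$. For $C_i=\mathbb R_+$, $\mathcal R_i=\{I_1\}$. For $u\in C$, $z\in\operatorname{tan}'(u,C)$ if and only if for every block $i$ there are $w_i,v_{iR}^+,v_{iR}^-\in C_i$ ($R\in\mathcal R_i$) with $u_i=w_i+\sum_{R}(v_{iR}^++v_{iR}^-)$ and $z_i=\sum_{R}R(v_{iR}^+-v_{iR}^-)$. The system $\mathfrak N(\Sigma)$. Let $T=\operatorname{rank}C$. $\mathfrak N(\Sigma)$ is the system in the unknowns $\eta,\lambda_1,\dots,\lambda_T$ (real vectors with as many entries as $B$ has rows) and $y_j,q_j,z_j$ (in the ambient space of $C$): $$y_j=B^T\lambda_j\ (1\le j\le T),\qquad y_{T+1}=-e_\tau-B^T\eta,$$ $$y_j=q_j+z_j,\ q_j\in C\ (1\le j\le T+1),\qquad z_1=0,\ z_j\in\operatorname{tan}'(q_{j-1},C)\ (2\le j\le T+1),$$ with each $\operatorname{tan}'$ membership expanded through its own fresh set of auxiliary variables and the affine equations above. Nonnegative scalar cones may be represented by Lorentz cones since $t\ge0$ if and only if $(t,0)\in\mathcal L_2$; free scalars may be split into differences of nonnegative scalars.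 So $\mathfrak N(\Sigma)$ consists of affine equations and Lorentz-cone memberships. Size is scalar formulation size: the total number of scalar decision-variable components, scalar affine equations, and coefficient occurrences, where a variable in $\mathcal L_k$ contributes $k$ scalar components and each real coefficient counts as one atomic scalar. *)

(* Defs.v *)
From HB Require Import structures.
From mathcomp Require Import all_boot all_order all_algebra.
From mathcomp Require Import all_classical all_reals.

Set Implicit Arguments.
Unset Strict Implicit.
Unset Printing Implicit Defensive.

Import Order.TTheory GRing.Theory Num.Theory.
Local Open Scope ring_scope.

(* The Lorentz cone in dimension k.+1: a vector is (t, z) with t its entry 0. *)
Definition lorentz (R : realType) (k : nat) (u : 'cV[R]_k.+1) : bool :=
  Num.sqrt (\sum_(a < k) u (lift ord0 a) ord0 ^+ 2) <= u ord0 ord0.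

(** Affine second-order cone systems
      D_i x + d_i \in L_(n_i)  (i < nu),   E x = f,   x \in R^d
    with n_i = (fp i).+2, so that n_i >= 2 holds by construction.
    The format collects the dimensions; the coefficient type K is a parameter
    so that coefficients may also be symbolic (see [coef]). *)

Record socfmt := SocFmt {
  fd : nat; fnu : nat; fp : 'I_fnu -> nat; fm : nat }.

Record socsys (K : Type) (F : socfmt) := SocSys {
  sD : forall i : 'I_(fnu F), 'M[K]_((fp i).+2, fd F);
  sd : forall i : 'I_(fnu F), 'cV[K]_((fp i).+2);
  sE : 'M[K]_(fm F, fd F);
  sf : 'cV[K]_(fm F) }.

Definition socmap (K L : Type) (F : socfmt) (g : K -> L) (S : socsys K F) :
    socsys L F :=
  SocSys (fun i => map_mx g (sD S i)) (fun i => map_mx g (sd S i))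
         (map_mx g (sE S)) (map_mx g (sf S)).

Definition solset (R : realType) (F : socfmt) (S : socsys R F) :
    set 'cV[R]_(fd F) :=
  [set x | (forall i, lorentz (sD S i *m x + sd S i)) /\ sE S *m x = sf S]%classic.

Definition feasible (R : realType) (F : socfmt) (S : socsys R F) : Prop :=
  (solset S !=set0)%classic.

Definition nnz (R : realType) (m n : nat) (A : 'M[R]_(m, n)) : nat :=
  #|[set ij : 'I_m * 'I_n | A ij.1 ij.2 != 0]|.

(* The system is counted in the form  s_i = D_i x + d_i, s_i \in L_(n_i),
   E x = f : variables x and s_i, then equations, then the coefficients, where
   s_i has n_i unit coefficients in its defining equations. *)
Definition socsize (R : realType) (F : socfmt) (S : socsys R F) : nat :=
  ((fd F + \sum_(i < fnu F) (fp i).+2)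
   + (\sum_(i < fnu F) (fp i).+2 + fm F)
   + (\sum_(i < fnu F) ((fp i).+2 + nnz (sD S i) + nnz (sd S i))
      + nnz (sE S) + nnz (sf S)))%N.

(** Symbolic coefficients: a rational number, or a rational multiple of one
    entry of the data of a system of format F. *)

Variant dpos (F : socfmt) :=
  | PosD (i : 'I_(fnu F)) of 'I_(fp i).+2 & 'I_(fd F)
  | Posd (i : 'I_(fnu F)) of 'I_(fp i).+2
  | PosE of 'I_(fm F) & 'I_(fd F)
  | Posf of 'I_(fm F).

Definition dentry (R : realType) (F : socfmt) (S : socsys R F) (p : dpos F) : R :=
  match p with
  | PosD i a j => sD S i a j
  | Posd i a => sd S i a ord0
  | PosE l j => sE S l j
  | Posf l => sf S l ord0
  end.

Definition coef (F : socfmt) : Type := (rat * option (dpos F))%type.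

Definition ceval (R : realType) (F : socfmt) (S : socsys R F) (c : coef F) : R :=
  ratr c.1 * (if c.2 is Some p then dentry S p else 1).

Definition coefs_over (G F : socfmt) (K : seq rat) (T : socsys (coef F) G) : Prop :=
  [/\ forall i a j, (sD T i a j).1 \in K,
      forall i a, (sd T i a ord0).1 \in K,
      forall l j, (sE T l j).1 \in K
    & forall l, (sf T l ord0).1 \in K].

Variant cone := Rplus | Lor of nat. (* [Lor p] is L_(p.+2) *)

Definition cpre (c : cone) : nat := if c is Lor p then p.+1 else 0.
Notation cdim c := (cpre c).+1.
Definition crank (c : cone) : nat := if c is Lor _ then 2 else 1.

Definition in_cone (R : realType) (c : cone) : 'cV[R]_(cdim c) -> bool :=
  match c return 'cV[R]_(cdim c) -> bool with
  | Rplus => fun u => 0 <= u ord0 ord0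
  | Lor p => fun u => lorentz u
  end.

Variant block (F : socfmt) :=
  | b_tau
  | b_xp of 'I_(fd F)
  | b_xm of 'I_(fd F)
  | b_s of 'I_(fnu F).
Arguments b_tau {F}.
Arguments b_xp {F}.
Arguments b_xm {F}.

Section BlockFinite.
Variable F : socfmt.
Definition block_code (b : block F) :
    (unit + 'I_(fd F) + 'I_(fd F) + 'I_(fnu F))%type :=
  match b with
  | b_tau => inl (inl (inl tt))
  | b_xp j => inl (inl (inr j))
  | b_xm j => inl (inr j)
  | b_s i => inr i
  end.
Definition block_decode (s : unit + 'I_(fd F) + 'I_(fd F) + 'I_(fnu F)) :
    block F :=
  match s with
  | inl (inl (inl _)) => b_tau
  | inl (inl (inr j)) => b_xp j
  | inl (inr j) => b_xm j
  | inr i => b_s i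
  end.
Lemma block_codeK : cancel block_code block_decode.
Proof. by case. Qed.
HB.instance Definition _ := Finite.copy (block F) (can_type block_codeK).
End BlockFinite.

Definition bcone (F : socfmt) (b : block F) : cone :=
  if b is b_s i then Lor (fp i) else Rplus.

Definition coord (F : socfmt) : finType := {b : block F & 'I_(cdim (bcone b))}.

Definition mkc (F : socfmt) (b : block F) (a : 'I_(cdim (bcone b))) : coord F :=
  Tagged (fun b => 'I_(cdim (bcone b))) a.
Definition c_tau (F : socfmt) : coord F := @mkc F b_tau ord0.
Definition c_xp (F : socfmt) (j : 'I_(fd F)) : coord F :=
  @mkc F (b_xp j) ord0.
Definition c_xm (F : socfmt) (j : 'I_(fd F)) : coord F :=
  @mkc F (b_xm j) ord0.
Definition c_s (F : socfmt) (i : 'I_(fnu F)) (a : 'I_(fp i).+2) : coord F :=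
  @mkc F (b_s i) a.

Definition rankC (F : socfmt) : nat := \sum_(b : block F) crank (bcone b).

(* Vectors (and linear forms) indexed by a finite type; R^o makes this an
   lmodType over R. *)
Notation vec R V := {ffun V -> R^o}.

Definition unitv (R : realType) (V : finType) (v : V) : vec R V :=
  [ffun w => (v == w)%:R].

Definition ambient (R : realType) (F : socfmt) := vec R (coord F).

Definition blk (R : realType) (F : socfmt) (u : ambient R F) (b : block F) :
    'cV[R]_(cdim (bcone b)) :=
  \col_a u (mkc a).

Definition inC (R : realType) (F : socfmt) (u : ambient R F) : Prop :=
  forall b, in_cone (blk u b).

Variant brow (F : socfmt) :=
  | r_s (i : 'I_(fnu F)) of 'I_(fp i).+2
  | r_E of 'I_(fm F).

Section BrowFinite.
Variable F : socfmt.
Definition brow_code (r : brow F) :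
    ({i : 'I_(fnu F) & 'I_(fp i).+2} + 'I_(fm F))%type :=
  match r with
  | r_s i a => inl (Tagged (fun i => 'I_(fp i).+2) a)
  | r_E l => inr l
  end.
Definition brow_decode (s : {i : 'I_(fnu F) & 'I_(fp i).+2} + 'I_(fm F)) :
    brow F :=
  match s with
  | inl (existT i a) => r_s a
  | inr l => r_E l
  end.
Lemma brow_codeK : cancel brow_code brow_decode.
Proof. by case. Qed.
HB.instance Definition _ := Finite.copy (brow F) (can_type brow_codeK).
End BrowFinite.

(* Rows of B:  s_i - D_i (x^+ - x^-) - tau d_i  and  E (x^+ - x^-) - tau f. *)
Definition Bmat (R : realType) (F : socfmt) (S : socsys R F) (r : brow F) :
    ambient R F :=
  match r with
  | r_s i a =>
      unitv R (c_s a)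
      - \sum_(j < fd F) sD S i a j *: (unitv R (c_xp j) - unitv R (c_xm j))
      - sd S i a ord0 *: unitv R (c_tau F)
  | r_E l =>
      \sum_(j < fd F) sE S l j *: (unitv R (c_xp j) - unitv R (c_xm j))
      - sf S l ord0 *: unitv R (c_tau F)
  end.

Definition Bmul (R : realType) (F : socfmt) (S : socsys R F) (h : ambient R F) :
    vec R (brow F) :=
  [ffun r => \sum_c Bmat S r c * h c].

Definition Btr (R : realType) (F : socfmt) (S : socsys R F)
    (l : vec R (brow F)) : ambient R F :=
  \sum_r l r *: Bmat S r.

Definition Hset (R : realType) (F : socfmt) (S : socsys R F) :
    set (ambient R F) :=
  [set h | Bmul S h = 0 /\ inC h]%classic.

(* None is the identity, Some (a, b) is S_ab J; for R_+ (k = 1) only the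
   identity remains. *)
Definition ridx (k : nat) : finType :=
  option {ab : 'I_k * 'I_k | (ab.1 < ab.2)%N}.

Definition Jmx (R : realType) (k : nat) : 'M[R]_k :=
  diag_mx (\row_a (if val a == 0%N then 1 else -1)).

Definition Smx (R : realType) (k : nat) (a b : 'I_k) : 'M[R]_k :=
  delta_mx a b - delta_mx b a.

Definition Rmx (R : realType) (k : nat) (r : ridx k) : 'M[R]_k :=
  if r is Some ab then Smx R (val ab).1 (val ab).2 *m Jmx R k else 1%:M.

Definition tan' (R : realType) (F : socfmt) (u : ambient R F) :
    set (ambient R F) :=
  [set z | forall b : block F,
    exists (w : 'cV[R]_(cdim (bcone b)))
           (vp vm : ridx (cdim (bcone b)) -> 'cV[R]_(cdim (bcone b))),
    [/\ in_cone w, forall r, in_cone (vp r), forall r, in_cone (vm r),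
        blk u b = w + \sum_r (vp r + vm r)
      & blk z b = \sum_r Rmx R r *m (vp r - vm r)]]%classic.

(** The system N(Sigma), first in terms of its unknowns.
    Indices start at 0: the unknowns y_1, ..., y_(T+1) are y 0, ..., y T and
    lambda_1, ..., lambda_T are lam 0, ..., lam (T-1).  For j : 'I_T,
    [ofst j] and [osnd j] are j and j + 1 in 'I_T.+1. *)

Definition ofst (T : nat) (j : 'I_T) : 'I_T.+1 := widen_ord (leqnSn T) j.
Definition osnd (T : nat) (j : 'I_T) : 'I_T.+1 := lift ord0 j.

Definition frakN_sol (R : realType) (F : socfmt) (S : socsys R F)
    (eta : vec R (brow F)) (lam : 'I_(rankC F) -> vec R (brow F))
    (y q z : 'I_(rankC F).+1 -> ambient R F) : Prop :=
  [/\ forall j, y (ofst j) = Btr S (lam j),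
      y ord_max = - unitv R (c_tau F) - Btr S eta,
      forall j, y j = q j + z j /\ inC (q j),
      z ord0 = 0
    & forall j : 'I_(rankC F), tan' (q (ofst j)) (z (osnd j))].

(* A system whose variables V, cones I and equations Q are indexed by finite
   types, with coefficients given by linear forms; cone i has dimension
   (p i).+2. *)
Definition mkfmt (V I Q : finType) (p : I -> nat) : socfmt :=
  @SocFmt #|V| #|I| (fun i => p (enum_val i)) #|Q|.

Definition mksoc (R : realType) (V I Q : finType) (p : I -> nat)
    (D : forall i, 'I_(p i).+2 -> vec R V) (d : forall i, 'I_(p i).+2 -> R)
    (E : Q -> vec R V) (f : Q -> R) : socsys R (mkfmt V Q p) :=
  @SocSys R (mkfmt V Q p)
    (fun i => \matrix_(a, j) D (enum_val i) a (enum_val j))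
    (fun i => \col_a d (enum_val i) a)
    (\matrix_(l, j) E (enum_val l) (enum_val j))
    (\col_l f (enum_val l)).

(* The variables.  The last two kinds are the auxiliary variables of
   z (osnd j) \in tan' (q (ofst j)):  [v_w j c] is coordinate c of w, and
   [v_v j s b r a] is coordinate a of v_(b,r)^+ (s = true) or v_(b,r)^-
   (s = false). *)
Variant nvar (F : socfmt) :=
  | v_eta of brow F
  | v_lam of 'I_(rankC F) & brow F
  | v_y of 'I_(rankC F).+1 & coord F
  | v_q of 'I_(rankC F).+1 & coord F
  | v_z of 'I_(rankC F).+1 & coord F
  | v_w of 'I_(rankC F) & coord F
  | v_v (j : 'I_(rankC F)) (s : bool) (b : block F)
        (r : ridx (cdim (bcone b))) (a : 'I_(cdim (bcone b))).

Variant ncone (F : socfmt) :=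
  | k_q of 'I_(rankC F).+1 & block F
  | k_w of 'I_(rankC F) & block F
  | k_v (j : 'I_(rankC F)) (s : bool) (b : block F)
        (r : ridx (cdim (bcone b))).

Variant neqn (F : socfmt) :=
  | q_y of 'I_(rankC F) & coord F        (* y_j = B^T lambda_j *)
  | q_ylast of coord F                   (* y_(T+1) = - e_tau - B^T eta *)
  | q_sum of 'I_(rankC F).+1 & coord F   (* y_j = q_j + z_j *)
  | q_z0 of coord F                      (* z_1 = 0 *)
  | q_tanu of 'I_(rankC F) & coord F     (* q_j = w + \sum_R (v_R^+ + v_R^-) *)
  | q_tanz of 'I_(rankC F) & coord F.    (* z_(j+1) = \sum_R R (v_R^+ - v_R^-) *)

Section NFinite.
Variable F : socfmt.
Local Notation T := (rankC F).

Definition nvar_sum : Type :=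
  (brow F + 'I_T * brow F
   + 'I_T.+1 * coord F + 'I_T.+1 * coord F + 'I_T.+1 * coord F
   + 'I_T * coord F
   + 'I_T * bool *
     {b : block F & (ridx (cdim (bcone b)) * 'I_(cdim (bcone b)))%type})%type.
Definition nvar_code (v : nvar F) : nvar_sum :=
  match v with
  | v_eta r => inl (inl (inl (inl (inl (inl r)))))
  | v_lam j r => inl (inl (inl (inl (inl (inr (j, r))))))
  | v_y j c => inl (inl (inl (inl (inr (j, c)))))
  | v_q j c => inl (inl (inl (inr (j, c))))
  | v_z j c => inl (inl (inr (j, c)))
  | v_w j c => inl (inr (j, c))
  | v_v j s b r a => inr (j, s, Tagged
      (fun b => (ridx (cdim (bcone b)) * 'I_(cdim (bcone b)))%type) (r, a))
  end.
Definition nvar_decode (s : nvar_sum) : nvar F :=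
  match s with
  | inl (inl (inl (inl (inl (inl r))))) => v_eta r
  | inl (inl (inl (inl (inl (inr (j, r)))))) => v_lam j r
  | inl (inl (inl (inl (inr (j, c))))) => v_y j c
  | inl (inl (inl (inr (j, c)))) => v_q j c
  | inl (inl (inr (j, c))) => v_z j c
  | inl (inr (j, c)) => v_w j c
  | inr (j, s, existT b (r, a)) => v_v j s r a
  end.
Lemma nvar_codeK : cancel nvar_code nvar_decode.
Proof. by case. Qed.
HB.instance Definition _ := Finite.copy (nvar F) (can_type nvar_codeK).

Definition ncone_sum : Type :=
  ('I_T.+1 * block F + 'I_T * block F
   + 'I_T * bool * {b : block F & ridx (cdim (bcone b))})%type.
Definition ncone_code (i : ncone F) : ncone_sum :=
  match i with
  | k_q j b => inl (inl (j, b))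
  | k_w j b => inl (inr (j, b))
  | k_v j s b r =>
      inr (j, s, Tagged (fun b => ridx (cdim (bcone b)) : Type) r)
  end.
Definition ncone_decode (s : ncone_sum) : ncone F :=
  match s with
  | inl (inl (j, b)) => k_q j b
  | inl (inr (j, b)) => k_w j b
  | inr (j, s, existT b r) => k_v j s r
  end.
Lemma ncone_codeK : cancel ncone_code ncone_decode.
Proof. by case. Qed.
HB.instance Definition _ := Finite.copy (ncone F) (can_type ncone_codeK).

Definition neqn_sum : Type :=
  ('I_T * coord F + coord F + 'I_T.+1 * coord F + coord F
   + 'I_T * coord F + 'I_T * coord F)%type.
Definition neqn_code (l : neqn F) : neqn_sum :=
  match l with
  | q_y j c => inl (inl (inl (inl (inl (j, c)))))
  | q_ylast c => inl (inl (inl (inl (inr c))))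
  | q_sum j c => inl (inl (inl (inr (j, c))))
  | q_z0 c => inl (inl (inr c))
  | q_tanu j c => inl (inr (j, c))
  | q_tanz j c => inr (j, c)
  end.
Definition neqn_decode (s : neqn_sum) : neqn F :=
  match s with
  | inl (inl (inl (inl (inl (j, c))))) => q_y j c
  | inl (inl (inl (inl (inr c)))) => q_ylast c
  | inl (inl (inl (inr (j, c)))) => q_sum j c
  | inl (inl (inr c)) => q_z0 c
  | inl (inr (j, c)) => q_tanu j c
  | inr (j, c) => q_tanz j c
  end.
Lemma neqn_codeK : cancel neqn_code neqn_decode.
Proof. by case. Qed.
HB.instance Definition _ := Finite.copy (neqn F) (can_type neqn_codeK).

End NFinite.

Definition nblock (F : socfmt) (i : ncone F) : block F :=
  match i with
  | k_q _ b => b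
  | k_w _ b => b
  | k_v _ _ b _ => b
  end.

Definition ncvar (F : socfmt) (i : ncone F) :
    'I_(cdim (bcone (nblock i))) -> nvar F :=
  match i return 'I_(cdim (bcone (nblock i))) -> nvar F with
  | k_q j b => fun a => v_q j (mkc a)
  | k_w j b => fun a => v_w j (mkc a)
  | k_v j s b r => fun a => v_v j s r a
  end.

(* t >= 0 is represented by (t, 0) \in L_2. *)
Definition lpre (c : cone) : nat := if c is Lor p then p else 0.

Definition lrows (R : realType) (V : finType) (c : cone) :
    ('I_(cdim c) -> vec R V) -> 'I_(lpre c).+2 -> vec R V :=
  match c return ('I_(cdim c) -> vec R V) -> 'I_(lpre c).+2 -> vec R V with
  | Rplus => fun g a => if a == ord0 then g ord0 else 0
  | Lor p => fun g => g
  end.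

Definition ncpre (F : socfmt) (i : ncone F) : nat := lpre (bcone (nblock i)).

Definition frakN_fmt (F : socfmt) : socfmt :=
  mkfmt (nvar F) (neqn F) (@ncpre F).

Definition neq_lhs (R : realType) (F : socfmt) (S : socsys R F) (l : neqn F) :
    vec R (nvar F) :=
  let e := @unitv R (nvar F) in
  match l with
  | q_y j c => e (v_y (ofst j) c) - \sum_r Bmat S r c *: e (v_lam j r)
  | q_ylast c => e (v_y ord_max c) + \sum_r Bmat S r c *: e (v_eta r)
  | q_sum j c => e (v_y j c) - e (v_q j c) - e (v_z j c)
  | q_z0 c => e (v_z ord0 c)
  | q_tanu j (existT b a) =>
      e (v_q (ofst j) (mkc a)) - e (v_w j (mkc a))
      - \sum_r (e (v_v j true r a) + e (v_v j false r a))
  | q_tanz j (existT b a) =>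
      e (v_z (osnd j) (mkc a))
      - \sum_(r : ridx (cdim (bcone b))) \sum_a'
          Rmx R r a a' *: (e (v_v j true r a') - e (v_v j false r a'))
  end.

Definition neq_rhs (R : realType) (F : socfmt) (l : neqn F) : R :=
  if l is q_ylast c then - unitv R (c_tau F) c else 0.

Definition frakN (R : realType) (F : socfmt) (S : socsys R F) :
    socsys R (frakN_fmt F) :=
  @mksoc R (nvar F) (ncone F) (neqn F) (@ncpre F)
    (fun i => lrows (fun a => unitv R (ncvar a)))
    (fun _ _ => 0) (neq_lhs S) (@neq_rhs R F).

(* Main.v *)
(* Write H for ker B \cap C.  A vector q_j of C exposes the face F_j = C \cap q_j^perp.
   For u in C and h in C with <u, h> = 0, every v <= u satisfies <v, h> = 0, and in a
   Lorentz block two orthogonal members v, h have h proportional to J v, so that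
   <S J v, h> = 0 for S skew.  Hence tan'(u, C) is orthogonal to C \cap u^perp, and by
   induction all q_j vanish on H, which forces h_tau <= 0 there.

   Conversely, suppose h_tau = 0 on H.  If a face F does not already satisfy
   - e_tau \in F^* + range B^T, a convex separation argument gives y \in F^* \cap range B^T
   not vanishing on F.  When u exposes F, up to rescaling u every y \in F^* splits as q + z
   with z \in tan'(u, C) and q \in C exposing F \cap y^perp: block by block, skew matrices
   map J u onto the whole hyperplane orthogonal to J u.  Each strict step lowers the rank
   of the face, so T steps suffice. *)

Require Import Defs.
From HB Require Import structures.
From mathcomp Require Import all_boot all_order all_algebra.
From mathcomp Require Import all_classical all_reals.
From mathcomp Require Import ring lra zify.

Set Implicit Arguments.
Unset Strict Implicit.
Unset Printing Implicit Defensive.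

Import Order.TTheory GRing.Theory Num.Theory.
Local Open Scope ring_scope.

(** * Positive functionals on cones with an order unit *)

Section PositiveFunctional.
Variables (R : realType) (V : lmodType R) (e : V).

(** A single conic alternative would not suffice, because the dual of a face plus range B^T need not
    be closed: the separating functional (lambda, mu) may have mu = 0 and then says nothing about
    h_tau. Such a functional is used to shrink the face instead. Separation is done without
    topology. Every face of C has an order unit, hence so does its image cone, and a Zorn-maximal
    cone with that order unit yields a positive functional with value 1 there. The relation z in
    tan'(u, C) bounds the vectors that make up z by u, so a given z may be reached only from a large
    multiple of u. All conditions before the last y are homogeneous, so the whole earlier chain can
    be multiplied by M; the one inhomogeneous vector, - e_tau - B^T eta, comes last and is never
    rescaled. The number of steps is T whatever the data; when the certificate appears early, the
    chain is filled up with y = 0. *)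

Definition convex_cone (K : set V) :=
  (forall x y, K x -> K y -> K (x + y)) /\
  (forall a x, 0 <= a -> K x -> K (a *: x)).

(** Only members of [K] have to be dominated by [e], since the image of a face need not span [V];
    domination of all of [V] is regained for maximal cones. Excluding [- e] is the properness that a
    positive functional with value 1 at [e] demands. *)
Definition unit_cone (K : set V) :=
  [/\ convex_cone K, forall x, K x -> exists N, K (N *: e - x), K e & ~ K (- e)].

Lemma maximal_unit_cone (K : set V) : unit_cone K ->
  exists A : set V, [/\ unit_cone A, (K `<=` A)%classic
    & forall B : set V, unit_cone B -> (A `<=` B)%classic -> (B `<=` A)%classic].
Proof.
move=> uK.
pose P (X : set V) := X = set0 \/ ((K `<=` X)%classic /\ unit_cone X).
have [F FP totF|A [[A0|[KA uA]] maxA]] := @Zorn_bigcup V P; last first.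
- exists A; split=> // B uB AB x Bx; apply: contrapT => nAx.
  apply: (maxA B); last by right; split=> //; exact: subset_trans AB.
  by split=> // BA; exact/nAx/BA.
- exfalso; have [_ _ Ke _] := uK; apply: (maxA K); last by right; split.
  by rewrite A0; split=> [x|/(_ e Ke)].
have [F0|] := pselect (exists2 X, F X & X !=set0)%classic; last first.
  move=> nF; left; rewrite -subset0 => x [X FX Xx].
  by apply: nF; exists X => //; exists x.
right; have inF X x : F X -> X x -> (K `<=` X)%classic /\ unit_cone X.
  by move=> FX Xx; have [X0|//] := FP _ FX; rewrite X0 in Xx.
have [X0 FX0 [x0 X0x0]] := F0; have [KX0 [_ _ X0e _]] := inF _ _ FX0 X0x0.
split; first by move=> x Kx; exists X0 => //; exact: KX0.
split; [split|..].
- move=> x y [X FX Xx] [Y FY Yy].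
  have [XY|YX] := totF _ _ FX FY.
    have [_ [[addY _] _ _ _]] := inF _ _ FY Yy.
    by exists Y => //; apply: addY => //; exact: XY.
  have [_ [[addX _] _ _ _]] := inF _ _ FX Xx.
  by exists X => //; apply: addX => //; exact: YX.
- move=> a x a0 [X FX Xx]; have [_ [[_ scaleX] _ _ _]] := inF _ _ FX Xx.
  by exists X => //; exact: scaleX.
- move=> x [X FX Xx]; have [_ [_ ouX _ _]] := inF _ _ FX Xx.
  by have [N XN] := ouX x Xx; exists N; exists X.
- by exists X0.
- by move=> [X FX Xe]; have [_ [_ _ _]] := inF _ _ FX Xe; apply.
Qed.

(** * Maximal proper cones and the functionals they define *)

Section Maximal.
Variable A : set V.
Hypothesis uA : unit_cone A.
Hypothesis maxA :
  forall B : set V, unit_cone B -> (A `<=` B)%classic -> (B `<=` A)%classic.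

Let addA x y : A x -> A y -> A (x + y). Proof. by case: uA => -[+ _] _ _ _; apply. Qed.
Let scaleA a x : 0 <= a -> A x -> A (a *: x).
Proof. by case: uA => -[_ +] _ _ _; apply. Qed.
Let nAe : ~ A (- e). Proof. by case: uA. Qed.
Let Ae : A e. Proof. by case: uA. Qed.
Let A0 : A 0. Proof. by rewrite -(scale0r e); exact: scaleA. Qed.
Let ouA x : A x -> exists N, A (N *: e - x).
Proof. by case: uA => _ + _ _; apply. Qed.

Lemma unit_cone_scale_ge0 r : A (r *: e) -> 0 <= r.
Proof.
move=> Are; rewrite leNgt; apply/negP => r0; apply: nAe.
have -> : - e = (- r)^-1 *: (r *: e).
  by rewrite scalerA -[r in _ * r]opprK mulrN mulVf ?scaleN1r// oppr_eq0 lt_eqF.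
by apply: scaleA => //; rewrite invr_ge0 oppr_ge0 ltW.
Qed.

(** By maximality it suffices that [A] plus the ray of [x] is again a unit cone. The bound on [x]
    gives its order unit property, and the second hypothesis says that it misses [- e]. *)
Lemma maximal_unit_cone_add x :
  (exists N, A (N *: e - x)) -> ~ (exists a t, [/\ A a, 0 <= t & - e = a + t *: x]) ->
  A x.
Proof.
move=> [N AN] nx; pose B := [set y | exists a t, [/\ A a, 0 <= t & y = a + t *: x]]%classic.
have AB : (A `<=` B)%classic.
  by move=> y Ay; exists y, 0; rewrite scale0r addr0.
have /maxA/(_ AB) : unit_cone B; last first.
  by apply; exists 0, 1; rewrite scale1r add0r.
split=> //; last exact: AB.
  split=> [_ _ [a [t [Aa t0 ->]]] [b [s [Ab s0 ->]]]|c _ c0 [a [t [Aa t0 ->]]]].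
    by exists (a + b), (t + s); rewrite addr_ge0// addrACA scalerDl; split=> //; exact: addA.
  by exists (c *: a), (c * t); rewrite mulr_ge0// scalerDr scalerA; split=> //; exact: scaleA.
move=> _ [a [t [Aa t0 ->]]]; have [M AM] := ouA Aa.
exists (M + t * N); apply: AB.
have -> : (M + t * N) *: e - (a + t *: x) = (M *: e - a) + t *: (N *: e - x).
  by rewrite scalerDl scalerBr scalerA opprD addrACA.
by apply: addA => //; exact: scaleA.
Qed.

(* If x were unbounded, adjoining the whole line through x would still be proper. *)
Lemma maximal_unit_cone_bounded x : exists N, A (N *: e - x).
Proof.
apply: contrapT => nb.
pose B := [set y | exists a t, A a /\ y = a + t *: x]%classic.
have AB : (A `<=` B)%classic.
  by move=> y Ay; exists y, 0; rewrite scale0r addr0.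
suff /maxA/(_ AB) Bx : unit_cone B.
  apply: nb; exists 0; rewrite scale0r add0r; apply: Bx.
  by exists 0, (-1); rewrite scaleN1r add0r.
split.
- split=> [_ _ [a [t [Aa ->]]] [b [s [Ab ->]]]|c _ c0 [a [t [Aa ->]]]].
    by exists (a + b), (t + s); rewrite addrACA scalerDl; split=> //; exact: addA.
  by exists (c *: a), (c * t); rewrite scalerDr scalerA; split=> //; exact: scaleA.
- move=> _ [a [t [Aa ->]]]; have [N AN] := ouA Aa.
  by exists N, (N *: e - a), (- t); rewrite opprD addrA scaleNr.
- exact: AB.
move=> [a [t [Aa Et]]].
(* Adjoining the line has reached [- e]. Unless t = 0, which puts [- e] in [A], the sign of t places
   [x] or [- x] in [A], and either way [x] is bounded. *)
have Etx : t *: x = - (e + a) by rewrite opprD Et addrAC subrr add0r.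
have [t0|t0|t0] := ltgtP t 0.
- have Ax : A x.
    have -> : x = (- t)^-1 *: (e + a).
      by rewrite -[e + a]opprK -Etx -scaleNr scalerA mulVf ?scale1r// oppr_eq0 lt_eqF.
    by apply: scaleA; [rewrite invr_ge0 oppr_ge0 ltW | exact: addA].
  by apply: nb; exact: ouA.
- apply: nb; exists 0; rewrite scale0r add0r.
  have -> : - x = t^-1 *: (e + a).
    by rewrite -[e + a]opprK -Etx scalerN scalerA mulVf ?scale1r// gt_eqF.
  by apply: scaleA; [rewrite invr_ge0 ltW | exact: addA].
- by apply: nAe; rewrite Et t0 scale0r addr0.
Qed.

(** If neither ray could be adjoined, [- e] would equal both a + t x and b - s x; weighting these by
    s and t cancels [x] and puts [- e] in [A]. *)
Lemma maximal_unit_cone_total x : A x \/ A (- x).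
Proof.
have [Ax|nAx] := pselect (A x); [by left|right].
have [[a [t [Aa t0 Et]]]|h] := pselect (exists a t, [/\ A a, 0 <= t & - e = a + t *: x]);
  last by exfalso; apply: nAx; apply: maximal_unit_cone_add => //; exact: maximal_unit_cone_bounded.
apply: maximal_unit_cone_add; first exact: maximal_unit_cone_bounded.
move=> [b [s [Ab s0 Es]]]; apply: nAe.
have [t_eq0|tn0] := eqVneq t 0; first by rewrite Et t_eq0 scale0r addr0.
have t_gt0 : 0 < t by rewrite lt_neqAle eq_sym tn0.
have st0 : 0 < s + t by rewrite ltr_wpDl.
have -> : - e = (s + t)^-1 *: (s *: a + t *: b).
  have -> : s *: a + t *: b = (s + t) *: (- e).
    rewrite scalerDl {1}Et {1}Es !scalerDr !scalerA.
    by rewrite addrACA [t * s]mulrC -scalerDr subrr scaler0 addr0.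
  by rewrite scalerA mulVf ?scale1r// gt_eqF.
by apply: scaleA; [rewrite invr_ge0 ltW | apply: addA; apply: scaleA => //; rewrite ltW].
Qed.

(** By totality each real r has x - r e or r e - x in [A], so the reals form a Dedekind cut and
    [phi x] is the cut point. It can therefore be approached from both sides, which gives
    additivity. *)
Let phi x := sup [set r | A (x - r *: e)]%classic.

Let phi_ub x r : A (r *: e - x) -> ubound [set s | A (x - s *: e)]%classic r.
Proof.
move=> Ar s /= As; rewrite -subr_ge0; apply: unit_cone_scale_ge0.
have -> : (r - s) *: e = (r *: e - x) + (x - s *: e) by rewrite addrA subrK scalerBl.
exact: addA.
Qed.

Let phi_has_sup x : has_sup [set r | A (x - r *: e)]%classic.
Proof.
split.
  have [N AN] := maximal_unit_cone_bounded (- x); exists (- N) => /=.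
  by rewrite scaleNr opprK addrC -[x in _ + x]opprK.
by have [N AN] := maximal_unit_cone_bounded x; exists N; exact: phi_ub.
Qed.

Let phi_ge x r : A (x - r *: e) -> r <= phi x.
Proof. by move=> Ar; apply: ub_le_sup => //; case: (phi_has_sup x). Qed.

Let phi_le x r : A (r *: e - x) -> phi x <= r.
Proof. by move=> Ar; apply: ge_sup; [case: (phi_has_sup x) | exact: phi_ub]. Qed.

Let phi_lt x r : r < phi x -> A (x - r *: e).
Proof.
move=> lt_r; have [//|] := maximal_unit_cone_total (x - r *: e).
by rewrite opprB => /phi_le; rewrite leNgt lt_r.
Qed.

Let phi_gt x r : phi x < r -> A (r *: e - x).
Proof.
move=> lt_r; have [//|] := maximal_unit_cone_total (r *: e - x).
by rewrite opprB => /phi_ge; rewrite leNgt lt_r.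
Qed.

Let phiD x y : phi (x + y) = phi x + phi y.
Proof.
apply/eqP; rewrite eq_le; apply/andP; split.
  rewrite leNgt; apply/negP => lt_r; pose d := (phi (x + y) - (phi x + phi y)) / 4.
  have d0 : 0 < d by rewrite /d; lra.
  have Ax : A ((phi x + d) *: e - x) by apply: phi_gt; lra.
  have Ay : A ((phi y + d) *: e - y) by apply: phi_gt; lra.
  have := addA Ax Ay; rewrite addrACA -scalerDl -opprD => /phi_le.
  rewrite /d; lra.
rewrite leNgt; apply/negP => lt_r; pose d := ((phi x + phi y) - phi (x + y)) / 4.
have d0 : 0 < d by rewrite /d; lra.
have Ax : A (x - (phi x - d) *: e) by apply: phi_lt; lra.
have Ay : A (y - (phi y - d) *: e) by apply: phi_lt; lra.
have := addA Ax Ay; rewrite addrACA -opprD -scalerDl => /phi_ge.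
rewrite /d; lra.
Qed.

Let phiN x : phi (- x) = - phi x.
Proof.
have phi0 : phi 0 = 0 by apply: (addrI (phi 0)); rewrite -phiD !addr0.
by apply: (addrI (phi x)); rewrite -phiD !subrr.
Qed.

Lemma unit_functional_of_maximal : exists phi : V -> R,
  [/\ forall x y, phi (x + y) = phi x + phi y, forall a x, phi (a *: x) = a * phi x,
      forall x, A x -> 0 <= phi x & phi e = 1].
Proof.
(* Only the upper bound needs an argument: applied to [- x] it gives the lower one. *)
have phi_le_scale a x : 0 < a -> phi (a *: x) <= a * phi x.
  move=> a0; rewrite leNgt; apply/negP; rewrite mulrC -ltr_pdivlMr//.
  set r := _ / a => lt_r; pose s := (phi x + r) / 2.
  have /phi_gt/(scaleA (ltW a0)) : phi x < s by rewrite /s; lra.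
  rewrite scalerBr scalerA => /phi_le; rewrite mulrC -ler_pdivrMr// -/r /s; lra.
have phi_pscale a x : 0 < a -> phi (a *: x) = a * phi x.
  move=> a0; apply/eqP; rewrite eq_le phi_le_scale//=.
  by have := phi_le_scale _ (- x) a0; rewrite scalerN !phiN mulrN lerN2.
exists phi; split=> //.
- move=> a x; have [a0|a0|->] := ltgtP a 0.
  + by rewrite -[a]opprK scaleNr phiN phi_pscale ?oppr_gt0// [RHS]mulNr.
  + exact: phi_pscale.
  + by rewrite scale0r mul0r; apply: (addrI (phi 0)); rewrite -phiD !addr0.
- by move=> x Ax; apply: phi_ge; rewrite scale0r subr0.
- apply/eqP; rewrite eq_le; apply/andP; split.
    by apply: phi_le; rewrite scale1r subrr; exact: A0.
  by apply: phi_ge; rewrite scale1r subrr; exact: A0.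
Qed.

End Maximal.

Lemma unit_cone_functional (K : set V) : unit_cone K ->
  exists phi : V -> R,
  [/\ forall x y, phi (x + y) = phi x + phi y, forall a x, phi (a *: x) = a * phi x,
      forall x, K x -> 0 <= phi x & phi e = 1].
Proof.
move=> /maximal_unit_cone[A [uA KA maxA]].
have [phi [phiD phiZ phi_ge0 phi_e]] := unit_functional_of_maximal uA maxA.
by exists phi; split=> // x /KA; exact: phi_ge0.
Qed.

End PositiveFunctional.

(** * The Lorentz cone *)

Section LorentzCone.
Variables (R : realType) (k : nat).
Implicit Types u v w h y z : 'cV[R]_k.+1.

Definition dotv u v : R := \sum_a u a ord0 * v a ord0.
Definition tail_dot u v : R := \sum_(a < k) u (lift ord0 a) ord0 * v (lift ord0 a) ord0.
Definition reflectJ u : 'cV[R]_k.+1 := Jmx R k.+1 *m u.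
(** The unit vector along the axis of the cone, an interior point; pairing with it reads off entry
    0. *)
Definition apex : 'cV[R]_k.+1 := delta_mx ord0 ord0.

Lemma dotvE u v : dotv u v = u ord0 ord0 * v ord0 ord0 + tail_dot u v.
Proof. by rewrite /dotv big_ord_recl. Qed.

Lemma dotvC u v : dotv u v = dotv v u.
Proof. by apply: eq_bigr => a _; rewrite mulrC. Qed.

Lemma dotvDr u v w : dotv u (v + w) = dotv u v + dotv u w.
Proof. by rewrite -big_split; apply: eq_bigr => a _; rewrite mxE mulrDr. Qed.

Lemma dotvZr a u v : dotv u (a *: v) = a * dotv u v.
Proof. by rewrite big_distrr; apply: eq_bigr => b _; rewrite mxE mulrCA. Qed.

Lemma dotvDl u v w : dotv (v + w) u = dotv v u + dotv w u.
Proof. by rewrite dotvC dotvDr !(dotvC u). Qed.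

Lemma dotvZl a u v : dotv (a *: v) u = a * dotv v u.
Proof. by rewrite dotvC dotvZr (dotvC u). Qed.

Lemma dotvBl u v w : dotv (v - w) u = dotv v u - dotv w u.
Proof. by rewrite -scaleN1r dotvDl dotvZl mulN1r. Qed.

Lemma dot0v u : dotv 0 u = 0.
Proof. by rewrite -(scale0r u) dotvZl mul0r. Qed.

Lemma dotv0 u : dotv u 0 = 0.
Proof. by rewrite dotvC dot0v. Qed.

Lemma dotv_suml (I : finType) (F : I -> 'cV[R]_k.+1) u :
  dotv (\sum_i F i) u = \sum_i dotv (F i) u.
Proof.
apply: (big_ind2 (fun v s => dotv v u = s)) => [|v s w t <- <-|//]; first exact: dot0v.
exact: dotvDl.
Qed.

Lemma dot_apex u : dotv apex u = u ord0 ord0.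
Proof.
rewrite dotvE !mxE !eqxx mul1r [tail_dot _ _]big1 ?addr0// => a _.
by rewrite mxE /= mul0r.
Qed.

Lemma reflectJ0 u : reflectJ u ord0 ord0 = u ord0 ord0.
Proof. by rewrite /reflectJ /Jmx mul_diag_mx !mxE /= mul1r. Qed.

Lemma reflectJS u a : reflectJ u (lift ord0 a) ord0 = - u (lift ord0 a) ord0.
Proof. by rewrite /reflectJ /Jmx mul_diag_mx !mxE /= mulN1r. Qed.

Lemma lorentzP u :
  reflect (0 <= u ord0 ord0 /\ tail_dot u u <= u ord0 ord0 ^+ 2) (lorentz u).
Proof.
have -> : tail_dot u u = \sum_(a < k) u (lift ord0 a) ord0 ^+ 2 by [].
have sq_ge0 : 0 <= \sum_(a < k) u (lift ord0 a) ord0 ^+ 2.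
  by apply: sumr_ge0 => a _; exact: sqr_ge0.
apply: (iffP idP) => [le_u|[u0 le_u]].
  have u0 : 0 <= u ord0 ord0 by exact: le_trans (sqrtr_ge0 _) le_u.
  by split=> //; rewrite -[leLHS]sqr_sqrtr// lerXn2r ?nnegrE ?sqrtr_ge0.
by rewrite /lorentz -[leRHS]ger0_norm// -sqrtr_sqr ler_wsqrtr.
Qed.

Lemma tail_dotD u v : tail_dot (u + v) (u + v) = tail_dot u u + 2 * tail_dot u v + tail_dot v v.
Proof.
rewrite big_distrr -!big_split; apply: eq_bigr => a _ /=.
by rewrite !mxE; ring.
Qed.

Lemma tail_dotZ a b u v : tail_dot (a *: u) (b *: v) = a * b * tail_dot u v.
Proof. by rewrite big_distrr; apply: eq_bigr => c _ /=; rewrite !mxE; ring. Qed.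

Lemma tail_dot_ge0 u : 0 <= tail_dot u u.
Proof. by apply: sumr_ge0 => a _; rewrite -expr2 sqr_ge0. Qed.

Lemma tail_dot_eq0 u : tail_dot u u = 0 -> forall a, u (lift ord0 a) ord0 = 0.
Proof.
move=> /eqP; rewrite psumr_eq0 => [/allP u0 a|a _]; last by rewrite -expr2 sqr_ge0.
by apply/eqP; rewrite -sqrf_eq0 expr2; apply: u0; rewrite mem_index_enum.
Qed.

Lemma lorentz_head0 u : lorentz u -> u ord0 ord0 = 0 -> u = 0.
Proof.
move=> /lorentzP[_ le_u] u0; apply/matrixP => i j; rewrite (ord1 j) mxE.
have [a ->|->//] := unliftP ord0 i; apply: tail_dot_eq0.
by apply/eqP; rewrite eq_le tail_dot_ge0 andbT; rewrite u0 expr0n /= in le_u.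
Qed.

(** A root-free Cauchy-Schwarz inequality: expand the square and bound each tail by its head. That
    the left side is nonnegative gives nonnegative pairings; that it vanishes gives
    proportionality. *)
Lemma lorentz_cross u h : lorentz u -> lorentz h ->
  tail_dot (h ord0 ord0 *: u + u ord0 ord0 *: h) (h ord0 ord0 *: u + u ord0 ord0 *: h)
    <= 2 * (u ord0 ord0 * h ord0 ord0) * dotv u h.
Proof.
move=> /lorentzP[u0 le_u] /lorentzP[h0 le_h].
rewrite tail_dotD !tail_dotZ dotvE.
have : h ord0 ord0 * h ord0 ord0 * tail_dot u u <= h ord0 ord0 * h ord0 ord0 * u ord0 ord0 ^+ 2.
  by apply: ler_wpM2l => //; exact: mulr_ge0.
have : u ord0 ord0 * u ord0 ord0 * tail_dot h h <= u ord0 ord0 * u ord0 ord0 * h ord0 ord0 ^+ 2.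
  by apply: ler_wpM2l => //; exact: mulr_ge0.
lra.
Qed.

Lemma dot_lorentz_ge0 u h : lorentz u -> lorentz h -> 0 <= dotv u h.
Proof.
move=> Lu Lh.
have [u0 _] := lorentzP _ Lu; have [h0 _] := lorentzP _ Lh.
have [/(lorentz_head0 Lu) ->|un0] := eqVneq (u ord0 ord0) 0; first by rewrite dot0v.
have [/(lorentz_head0 Lh) ->|hn0] := eqVneq (h ord0 ord0) 0; first by rewrite dotv0.
have uh : 0 < 2 * (u ord0 ord0 * h ord0 ord0).
  by rewrite !mulr_gt0// lt_neqAle eq_sym ?un0 ?hn0.
rewrite -(pmulr_rge0 _ uh); exact: le_trans (tail_dot_ge0 _) (lorentz_cross Lu Lh).
Qed.

(** A zero pairing kills the square in [lorentz_cross], hence the tail of h_0 u + u_0 h. Without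
    division the conclusion also covers zero heads. *)
Lemma dot_lorentz_eq0 u h : lorentz u -> lorentz h -> dotv u h = 0 ->
  u ord0 ord0 *: h = h ord0 ord0 *: reflectJ u.
Proof.
move=> Lu Lh uh0; have := lorentz_cross Lu Lh; rewrite uh0 mulr0 => le0.
have /tail_dot_eq0 eq0 := le_anti (introT andP (conj le0 (tail_dot_ge0 _))).
apply/matrixP => i j; rewrite (ord1 j) [LHS]mxE [RHS]mxE.
have [a ->|->] := unliftP ord0 i; last by rewrite reflectJ0 mulrC.
by rewrite reflectJS mulrN; have := eq0 a; rewrite !mxE => /eqP; rewrite addrC addr_eq0 => /eqP.
Qed.

Lemma lorentz0 : lorentz (0 : 'cV[R]_k.+1).
Proof.
apply/lorentzP; rewrite mxE; split=> //.
by rewrite expr0n /= [tail_dot _ _]big1// => a _; rewrite mxE mul0r.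
Qed.

Lemma lorentz_apex : lorentz apex.
Proof.
apply/lorentzP; rewrite mxE; split=> //.
by rewrite /= expr1n [tail_dot _ _]big1// => a _; rewrite !mxE /= mul0r.
Qed.

Lemma lorentzZ a u : 0 <= a -> lorentz u -> lorentz (a *: u).
Proof.
move=> a0 /lorentzP[u0 le_u]; apply/lorentzP; rewrite mxE mulr_ge0//; split=> //.
by rewrite tail_dotZ exprMn -expr2 ler_wpM2l// sqr_ge0.
Qed.

Lemma lorentz_reflectJ u : lorentz u -> lorentz (reflectJ u).
Proof.
move=> /lorentzP[u0 le_u]; apply/lorentzP; rewrite reflectJ0; split=> //.
suff -> : tail_dot (reflectJ u) (reflectJ u) = tail_dot u u by [].
by apply: eq_bigr => a _; rewrite reflectJS mulrNN.
Qed.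

(** The triangle inequality for tails comes from the nonnegative pairing of [u] with the reflection
    of [v], which bounds [tail_dot u v] by u_0 v_0. *)
Lemma lorentzD u v : lorentz u -> lorentz v -> lorentz (u + v).
Proof.
move=> Lu Lv; have := dot_lorentz_ge0 Lu (lorentz_reflectJ Lv).
have -> : dotv u (reflectJ v) = u ord0 ord0 * v ord0 ord0 - tail_dot u v.
  rewrite dotvE reflectJ0; congr (_ + _); rewrite -sumrN.
  by apply: eq_bigr => a _; rewrite reflectJS mulrN.
move: Lu Lv => /lorentzP[u0 le_u] /lorentzP[v0 le_v] le_uv.
apply/lorentzP; rewrite mxE addr_ge0//; split=> //; rewrite tail_dotD sqrrD mulr2n.
lra.
Qed.

Lemma lorentz_apex_bound z : exists2 N, 0 <= N & lorentz (N *: apex + z).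
Proof.
exists (Num.sqrt (tail_dot z z) + `|z ord0 ord0|); first by rewrite addr_ge0// sqrtr_ge0.
have hd0 : `|z ord0 ord0| + z ord0 ord0 >= 0.
  by have := lerNnormlW (lexx `|z ord0 ord0|); lra.
have tl : tail_dot ((Num.sqrt (tail_dot z z) + `|z ord0 ord0|) *: apex + z)
    ((Num.sqrt (tail_dot z z) + `|z ord0 ord0|) *: apex + z) = tail_dot z z.
  by apply: eq_bigr => a _; rewrite !mxE /= mulr0 add0r.
have s0 := sqrtr_ge0 (tail_dot z z).
apply/lorentzP; rewrite tl !mxE eqxx mulr1 -addrA; split; first exact: addr_ge0.
by rewrite -[leLHS]sqr_sqrtr ?tail_dot_ge0// lerXn2r ?lerDl// nnegrE addr_ge0.
Qed.

(** The pairing of [u] with [reflectJ u] is the quadratic form u_0^2 - |tail|^2. The cases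
    correspond to the exposed face: the whole cone, the ray of [reflectJ u], or 0. *)
Variant lorentz_spec u : Prop :=
  | LorentzZero of u = 0
  | LorentzRay of 0 < u ord0 ord0 & dotv u (reflectJ u) = 0
  | LorentzInterior d of 0 < d & lorentz (u - d *: apex).

Lemma lorentz_cases u : lorentz u -> lorentz_spec u.
Proof.
move=> Lu; have [u0 le_u] := lorentzP _ Lu.
have [/(lorentz_head0 Lu) u_eq0|un0] := eqVneq (u ord0 ord0) 0; first exact: LorentzZero.
have {u0 un0} u0 : 0 < u ord0 ord0 by rewrite lt_neqAle eq_sym un0.
have dJ : dotv u (reflectJ u) = u ord0 ord0 ^+ 2 - tail_dot u u.
  rewrite dotvE reflectJ0 -expr2; congr (_ + _); rewrite -sumrN.
  by apply: eq_bigr => a _; rewrite reflectJS mulrN.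
have [eq_u|ne_u] := eqVneq (tail_dot u u) (u ord0 ord0 ^+ 2).
  by apply: LorentzRay => //; rewrite dJ eq_u subrr.
(* The largest margin: subtracting it along the axis puts [u] on the boundary. *)
apply: (@LorentzInterior _ (u ord0 ord0 - Num.sqrt (tail_dot u u))).
  rewrite subr_gt0 -(ltr_pXn2r (n := 2)) ?nnegrE ?sqrtr_ge0 ?ltW//.
  by rewrite sqr_sqrtr ?tail_dot_ge0// lt_neqAle ne_u.
apply/lorentzP.
have -> : tail_dot (u - (u ord0 ord0 - Num.sqrt (tail_dot u u)) *: apex)
   (u - (u ord0 ord0 - Num.sqrt (tail_dot u u)) *: apex) = tail_dot u u.
  by apply: eq_bigr => a _; rewrite !mxE /= mulr0 subr0.
by rewrite !mxE eqxx mulr1 subKr sqrtr_ge0 sqr_sqrtr ?tail_dot_ge0.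
Qed.

Lemma lorentz_interior_perp u d h : 0 < d -> lorentz (u - d *: apex) -> lorentz h ->
  dotv u h = 0 -> h = 0.
Proof.
move=> d0 Lu Lh uh; apply: lorentz_head0 => //.
have := dot_lorentz_ge0 Lu Lh; rewrite dotvBl uh dotvZl dot_apex sub0r oppr_ge0.
rewrite pmulr_rle0// => le0; apply/eqP; rewrite eq_le le0 /=.
by have [] := lorentzP _ Lh.
Qed.

Lemma lorentz_perp_ray u h : 0 < u ord0 ord0 -> lorentz u -> lorentz h -> dotv u h = 0 ->
  h = (h ord0 ord0 / u ord0 ord0) *: reflectJ u.
Proof.
move=> u0 Lu Lh /(dot_lorentz_eq0 Lu Lh) eq_h.
by rewrite mulrC -scalerA -eq_h scalerA mulVf ?scale1r// gt_eqF.
Qed.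

Lemma lorentz_selfdual y : (forall h, lorentz h -> 0 <= dotv y h) -> lorentz y.
Proof.
move=> y_ge0; apply/lorentzP.
have y0 : 0 <= y ord0 ord0 by rewrite -dot_apex dotvC y_ge0// lorentz_apex.
split=> //; have [->|tn0] := eqVneq (tail_dot y y) 0; first exact: sqr_ge0.
have t0 : 0 < tail_dot y y by rewrite lt_neqAle eq_sym tn0 tail_dot_ge0.
pose s := Num.sqrt (tail_dot y y).
have s0 : 0 < s by rewrite sqrtr_gt0.
have ss : s ^+ 2 = tail_dot y y by rewrite sqr_sqrtr ?ltW.
(* The test vector is (s, - tail of y), a boundary point whose pairing with [y] is s (y_0 - s). *)
pose h := s *: apex + reflectJ (y - y ord0 ord0 *: apex).
have h0 : h ord0 ord0 = s by rewrite mxE reflectJ0 !mxE eqxx !mulr1 subrr addr0.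
have hS a : h (lift ord0 a) ord0 = - y (lift ord0 a) ord0.
  by rewrite mxE reflectJS !mxE /= !mulr0 add0r subr0.
have /y_ge0 : lorentz h.
  apply/lorentzP; rewrite h0 ss ltW//; split=> //.
  suff -> : tail_dot h h = tail_dot y y by [].
  by apply: eq_bigr => a _; rewrite hS mulrNN.
have -> : dotv y h = s * (y ord0 ord0 - s).
  rewrite dotvE h0 mulrBr -expr2 ss mulrC; congr (_ + _); rewrite -sumrN.
  by apply: eq_bigr => a _; rewrite hS mulrN.
by rewrite pmulr_rge0// subr_ge0 -ss => le_s; rewrite lerXn2r ?nnegrE// ltW.
Qed.

(** One block of [tan']. As a relation it is a convex cone in (u, z) jointly, and it persists when a
    cone member is added to [u], since that member can be absorbed in [w]. *)
Definition btan u z : Prop :=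
  exists w (vp vm : ridx k.+1 -> 'cV[R]_k.+1),
    [/\ lorentz w, forall r, lorentz (vp r), forall r, lorentz (vm r),
        u = w + \sum_r (vp r + vm r) & z = \sum_r Rmx R r *m (vp r - vm r)].

Lemma btan0 : btan 0 0.
Proof.
exists 0, (fun=> 0), (fun=> 0); split=> [|r|r||]; try exact: lorentz0.
- by rewrite add0r big1// => r _; rewrite addr0.
- by rewrite big1// => r _; rewrite subr0 mulmx0.
Qed.

Lemma btanD u u' z z' : btan u z -> btan u' z' -> btan (u + u') (z + z').
Proof.
move=> [w [vp [vm [Lw Lp Lm -> ->]]]] [w' [vp' [vm' [Lw' Lp' Lm' -> ->]]]].
exists (w + w'), (fun r => vp r + vp' r), (fun r => vm r + vm' r).
split=> [|r|r||]; try exact: lorentzD.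
- by rewrite addrACA -big_split; congr (_ + _); apply: eq_bigr => r _; rewrite addrACA.
- by rewrite -big_split; apply: eq_bigr => r _ /=; rewrite -mulmxDr opprD addrACA.
Qed.

Lemma btanZ a u z : 0 <= a -> btan u z -> btan (a *: u) (a *: z).
Proof.
move=> a0 [w [vp [vm [Lw Lp Lm -> ->]]]].
exists (a *: w), (fun r => a *: vp r), (fun r => a *: vm r).
split=> [|r|r||]; try exact: lorentzZ.
- by rewrite scalerDr scaler_sumr; congr (_ + _); apply: eq_bigr => r _; rewrite scalerDr.
- by rewrite scaler_sumr; apply: eq_bigr => r _; rewrite -scalerBr -scalemxAr.
Qed.

Lemma btan_weaken u w z : btan u z -> lorentz w -> btan (u + w) z.
Proof.
move=> Tu Lw; rewrite -[z]addr0; apply: btanD => //.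
exists w, (fun=> 0), (fun=> 0); split=> [|r|r||]; try exact: lorentz0; first exact: Lw.
- by rewrite big1 ?addr0// => r _; rewrite addr0.
- by rewrite big1// => r _; rewrite subr0 mulmx0.
Qed.

Lemma btan_Rmx r (u v : 'cV[R]_k.+1) : lorentz u -> lorentz v ->
  btan (u + v) (Rmx R r *m (u - v)).
Proof.
move=> Lu Lv.
exists 0, (fun s => if s == r then u else 0), (fun s => if s == r then v else 0).
split=> [|s|s||]; try by [exact: lorentz0 | case: ifP => // _; exact: lorentz0].
- by rewrite add0r (bigD1 r)//= eqxx big1 ?addr0// => s /negPf ->; rewrite addr0.
- by rewrite (bigD1 r)//= eqxx big1 ?addr0// => s /negPf ->; rewrite subr0 mulmx0.
Qed.

(** Here R = I is enough: z is the difference of (M u + z) / 2 and (M u - z) / 2, whose sum is M u,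
    and both lie in the cone for large M. *)
Lemma btan_interior u d z : 0 < d -> lorentz (u - d *: apex) ->
  exists2 M, 0 <= M & btan (M *: u) z.
Proof.
move=> d0 Lu.
have [M1 M10 L1] := lorentz_apex_bound z; have [M2 M20 L2] := lorentz_apex_bound (- z).
(* With M d = M1 + M2, the vector M u dominates (M1 + M2) [apex], which covers both z and - z. *)
pose M := (M1 + M2) / d.
have M0 : 0 <= M by rewrite divr_ge0 ?addr_ge0// ltW.
have L z' N : 0 <= N -> N <= M1 + M2 -> lorentz (N *: apex + z') -> lorentz (M *: u + z').
  move=> N0 le_N LN.
  have -> : M *: u + z' = M *: (u - d *: apex) + ((M1 + M2 - N) *: apex + (N *: apex + z')).
    rewrite (addrA (_ *: apex)) -scalerDl subrK scalerBr scalerA /M divfK ?gt_eqF//.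
    by rewrite addrA subrK.
  apply: lorentzD; [exact: lorentzZ | apply: lorentzD => //].
  by apply: lorentzZ; [rewrite subr_ge0 | exact: lorentz_apex].
exists M => //.
have La : lorentz (2^-1 *: (M *: u + z)).
  by apply: lorentzZ; [rewrite invr_ge0 | apply: (L _ M1) => //; rewrite lerDl].
have Lb : lorentz (2^-1 *: (M *: u - z)).
  by apply: lorentzZ; [rewrite invr_ge0 | apply: (L _ M2) => //; rewrite lerDr].
have := btan_Rmx None La Lb; rewrite mul1mx -scalerDr -scalerBr.
have -> : M *: u + z + (M *: u - z) = 2 *: (M *: u) by apply/matrixP => i j; rewrite !mxE; ring.
have -> : M *: u + z - (M *: u - z) = 2 *: z by apply/matrixP => i j; rewrite !mxE; ring.
by rewrite !(scalerA _ 2) mulVf ?scale1r// pnatr_eq0.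
Qed.

End LorentzCone.

(** * Faces of the Lorentz cone *)

Section LorentzFaces.
Variables (R : realType) (k : nat).
Implicit Types u v w h y z : 'cV[R]_k.+1.

Lemma Smx_mul (a b : 'I_k.+1) v :
  Smx R a b *m v = v b ord0 *: delta_mx a ord0 - v a ord0 *: delta_mx b ord0.
Proof.
have dE c c' : delta_mx c c' *m v = v c' ord0 *: delta_mx c ord0.
  apply/matrixP => i j; rewrite (ord1 j) !mxE (bigD1 c')//= !mxE !eqxx big1 ?addr0.
    by rewrite andbT mulrC.
  by move=> l /negPf lc; rewrite mxE lc andbF mul0r.
by rewrite /Smx mulmxBl !dE.
Qed.

Lemma Rmx_some (ab : {ab : 'I_k.+1 * 'I_k.+1 | (ab.1 < ab.2)%N}) v :
  Rmx R (Some ab) *m v = Smx R (val ab).1 (val ab).2 *m reflectJ v.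
Proof. by rewrite /reflectJ mulmxA. Qed.

Lemma btan_perp u z h : lorentz u -> lorentz h -> btan u z -> dotv u h = 0 -> dotv z h = 0.
Proof.
move=> Lu Lh [w [vp [vm [Lw Lp Lm -> ->]]]].
have ge0 v : lorentz v -> 0 <= dotv v h by move=> Lv; exact: dot_lorentz_ge0.
have sum_ge0 : 0 <= \sum_r (dotv (vp r) h + dotv (vm r) h).
  by apply: sumr_ge0 => r _; rewrite addr_ge0 ?ge0.
rewrite dotvDl dotv_suml; under eq_bigr do rewrite dotvDl.
move=> /eqP; rewrite paddr_eq0 ?ge0// => /andP[_]; rewrite psumr_eq0; last first.
  by move=> r _; rewrite addr_ge0 ?ge0.
move=> /allP v0; rewrite dotv_suml big1// => r _.
have /andP[/eqP p0 /eqP m0] : (dotv (vp r) h == 0) && (dotv (vm r) h == 0).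
  by rewrite -paddr_eq0 ?ge0//; apply: v0; rewrite mem_index_enum.
have R0 v : lorentz v -> dotv v h = 0 -> dotv (Rmx R r *m v) h = 0.
  move=> Lv vh; case: r {p0 m0} => [ab|]; last by rewrite mul1mx.
  have [/(lorentz_head0 Lv) ->|vn0] := eqVneq (v ord0 ord0) 0; first by rewrite mulmx0 dot0v.
  have v0' : 0 < v ord0 ord0 by rewrite lt_neqAle eq_sym vn0; case/lorentzP: Lv.
  rewrite (lorentz_perp_ray v0' Lv Lh vh) dotvZr Rmx_some Smx_mul dotvBl !dotvZl.
  have dE c g : dotv (delta_mx c ord0) g = g c ord0.
    rewrite /dotv (bigD1 c)//= mxE !eqxx mul1r big1 ?addr0// => l /negPf lc.
    by rewrite mxE lc mul0r.
  by rewrite !dE [X in X - _]mulrC subrr mulr0.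
by rewrite mulmxBr dotvBl !R0 ?subr0.
Qed.

Lemma btan_ray u z : lorentz u -> 0 < u ord0 ord0 -> dotv z (reflectJ u) = 0 ->
  exists2 M, 0 <= M & btan (M *: u) z.
Proof.
move=> Lu u0 zJ.
pose P z := exists2 M, 0 <= M & btan (M *: u) z.
have PD z1 z2 : P z1 -> P z2 -> P (z1 + z2).
  move=> [M M0 T1] [N N0 T2]; exists (M + N); first exact: addr_ge0.
  by rewrite scalerDl; exact: btanD.
have PR c r : P (c *: (Rmx R r *m u)).
  exists (`|c|) => //; have [c0|c0] := leP 0 c.
    have := btan_Rmx r (lorentzZ c0 Lu) (lorentz0 R k).
    by rewrite addr0 subr0 ger0_norm// scalemxAr.
  have cN : 0 <= - c by rewrite oppr_ge0 ltW.
  have := btan_Rmx r (lorentz0 R k) (lorentzZ cN Lu).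
  by rewrite add0r sub0r ltr0_norm// -scaleNr opprK scalemxAr.
pose r (b : 'I_k) : ridx k.+1 :=
  Some (exist (fun ab : 'I_k.+1 * 'I_k.+1 => (ab.1 < ab.2)%N : Prop) (ord0, lift ord0 b) erefl).
(* The matrices S_0b suffice. As S_0b J u = - u_b e_0 - u_0 e_b, these coefficients reproduce the
   tail entrywise, and the head then agrees because z is orthogonal to J u. *)
have -> : z = \sum_(b < k) (- z (lift ord0 b) ord0 / u ord0 ord0)
    *: (Rmx R (r b) *m u).
  under eq_bigr do rewrite Rmx_some Smx_mul /= reflectJ0 reflectJS.
  apply/matrixP => i j; rewrite (ord1 j) summxE.
  have un0 : u ord0 ord0 != 0 by rewrite gt_eqF.
  have [a ->|->] := unliftP ord0 i.
    rewrite (bigD1 a)//= !mxE !eqxx /= big1 ?addr0; first by field.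
    by move=> l /negPf la; rewrite !mxE /= (inj_eq lift_inj) [a == l]eq_sym la /=; ring.
  move: zJ; rewrite dotvE reflectJ0 => /eqP; rewrite addr_eq0 => /eqP zu.
  apply: (mulIf un0); rewrite zu big_distrl -sumrN; apply: eq_bigr => b _ /=.
  by rewrite reflectJS !mxE eqxx /=; field.
apply: (big_ind P) => //; exists 0 => //; rewrite scale0r; exact: btan0.
Qed.

(** Tangential vectors at multiples of [u] fill 0, the hyperplane orthogonal to J u, or the whole
    space, when the face is the cone, a ray, or 0. In each case some [q] that differs from [y] by
    such a vector exposes the part of the face where [y] vanishes. *)
Lemma cone_step u y : lorentz u -> (forall h, lorentz h -> dotv u h = 0 -> 0 <= dotv y h) ->
  exists M q z, [/\ 0 <= M, lorentz q, btan (M *: u) z, y = q + z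
    & forall h, lorentz h -> (dotv q h = 0 <-> dotv u h = 0 /\ dotv y h = 0)].
Proof.
move=> Lu y_ge0; have [u0|u0 uJ|d d0 Ld] := lorentz_cases Lu.
- exists 0, y, 0; rewrite addr0 scale0r; split=> //.
  + by apply: lorentz_selfdual => h Lh; apply: y_ge0; rewrite // u0 dot0v.
  + exact: btan0.
  + by move=> h _; rewrite u0 dot0v; split=> [|[]].
- have Ju0 : 0 <= dotv y (reflectJ u) by apply: y_ge0 => //; exact: lorentz_reflectJ.
  have [yJ|yJn0] := eqVneq (dotv y (reflectJ u)) 0.
    (* [y] vanishes on the ray, so the face is kept by taking q = u; y - u is orthogonal to J u
       because [u] is on the boundary. *)
    have [|M M0 Tz] := @btan_ray u (y - u) Lu u0; first by rewrite dotvBl yJ uJ subrr.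
    exists M, u, (y - u); split=> //; first by rewrite addrC subrK.
    move=> h Lh; split=> [uh|[]//]; split=> //.
    by rewrite (lorentz_perp_ray u0 Lu Lh uh) dotvZr yJ mulr0.
  have yJ : 0 < dotv y (reflectJ u) by rewrite lt_neqAle eq_sym yJn0.
  (* Chosen so that y - c [apex] is orthogonal to J u; as c > 0, the new face is 0. *)
  pose c := dotv y (reflectJ u) / u ord0 ord0.
  have c0 : 0 < c by rewrite divr_gt0.
  have [|M M0 Tz] := @btan_ray u (y - c *: apex R k) Lu u0.
    by rewrite dotvBl dotvZl dot_apex reflectJ0 divfK ?gt_eqF// subrr.
  exists M, (c *: apex R k), (y - c *: apex R k); split=> //.
  + by apply: lorentzZ; [exact: ltW | exact: lorentz_apex].
  + by rewrite addrC subrK.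
  move=> h Lh; rewrite dotvZl dot_apex; split=> [/eqP|[uh yh]].
    rewrite mulf_eq0 gt_eqF//= => /eqP /(lorentz_head0 Lh) ->.
    by rewrite !dotv0.
  have /eqP := yh; rewrite (lorentz_perp_ray u0 Lu Lh uh) dotvZr mulf_eq0 (gt_eqF yJ) orbF.
  by rewrite mulf_eq0 invr_eq0 (gt_eqF u0) orbF => /eqP ->; rewrite mul0r !mxE mul0r mulr0.
- have [M M0 Tz] := btan_interior (y - apex R k) d0 Ld.
  exists M, (apex R k), (y - apex R k); split=> //.
  + exact: lorentz_apex.
  + by rewrite addrC subrK.
  move=> h Lh; rewrite dot_apex; split=> [/(lorentz_head0 Lh) ->|[uh _]].
    by rewrite !dotv0.
  by rewrite (lorentz_interior_perp d0 Ld Lh uh) mxE.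
Qed.

Lemma face_order_unit u : lorentz u ->
  exists f, [/\ lorentz f, dotv u f = 0
    & forall h, lorentz h -> dotv u h = 0 -> exists2 N, 0 <= N & lorentz (N *: f - h)].
Proof.
move=> Lu; have [u0|u0 uJ|d d0 Ld] := lorentz_cases Lu.
- exists (apex R k); rewrite u0 dot0v; split=> //; first exact: lorentz_apex.
  by move=> h _ _; exact: lorentz_apex_bound.
- exists (reflectJ u); split=> //; first exact: lorentz_reflectJ.
  move=> h Lh uh; rewrite (lorentz_perp_ray u0 Lu Lh uh).
  exists (h ord0 ord0 / u ord0 ord0); last by rewrite subrr; exact: lorentz0.
  by rewrite divr_ge0 ?(ltW u0)//; case/lorentzP: Lh.
- exists 0; rewrite dotv0; split=> //; first exact: lorentz0.
  move=> h Lh uh; exists 0 => //.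
  by rewrite (lorentz_interior_perp d0 Ld Lh uh) scaler0 subr0; exact: lorentz0.
Qed.

(* The rank of the face exposed by u; m is the rank of the whole cone, since R_+ is
   treated as the Lorentz cone with k = 0 but has rank 1. *)
Definition face_rank (m : nat) u : nat :=
  if u == 0 then m else if dotv u (reflectJ u) == 0 then 1 else 0.

(** Faces drop along m, 1, 0, and two nested faces of equal rank coincide. The second hypothesis on
    m keeps a ray apart from the whole cone; for k = 0 there are no proper rays. *)
Lemma face_rank_mono m u q : (0 < m)%N -> ((0 < k)%N -> (1 < m)%N) ->
  lorentz u -> lorentz q ->
  (forall h, lorentz h -> dotv q h = 0 -> dotv u h = 0) ->
  (face_rank m q <= face_rank m u)%N /\
  (face_rank m q = face_rank m u -> forall h, lorentz h -> dotv u h = 0 -> dotv q h = 0).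
Proof.
move=> m0 m1 Lu Lq sub; rewrite /face_rank.
have ray_k v : 0 < v ord0 ord0 -> dotv v (reflectJ v) = 0 -> (0 < k)%N.
  move=> v0; rewrite dotvE reflectJ0; case: (k) v v0 => [v v0|//].
  rewrite /tail_dot big_ord0 addr0 => /eqP; rewrite mulf_eq0 orbb => /eqP v00.
  by rewrite v00 ltxx in v0.
have q_eq0 : q = 0 -> u = 0.
  move=> q0; have := sub _ (lorentz_apex R k); rewrite q0 dot0v dotvC dot_apex.
  by move=> /(_ erefl); exact: lorentz_head0.
have [->|un0] := eqVneq u 0.
  have [->|qn0] := eqVneq q 0; first by split.
  have [q0|q0 qJ|d d0 Ld] := lorentz_cases Lq; first by rewrite q0 eqxx in qn0.
    rewrite qJ eqxx; split=> // m_eq; have := m1 (ray_k _ q0 qJ); by rewrite -m_eq.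
  case: eqP => [qJ|_]; last by split=> // m_eq; rewrite -m_eq in m0.
  have q00 : 0 < q ord0 ord0.
    rewrite lt_neqAle eq_sym; case/lorentzP: (Lq) => -> _; rewrite andbT.
    by apply: contraNneq qn0 => /(lorentz_head0 Lq) ->.
  by split=> // m_eq; have := m1 (ray_k _ q00 qJ); rewrite -m_eq.
have qn0 : q != 0 by apply: contraNneq un0 => /q_eq0 ->.
rewrite (negPf qn0).
have pos v : lorentz v -> v != 0 -> 0 < v ord0 ord0.
  move=> Lv vn0; rewrite lt_neqAle eq_sym; case/lorentzP: (Lv) => -> _; rewrite andbT.
  by apply: contraNneq vn0 => /(lorentz_head0 Lv) ->.
have [uJ|uJn0] := eqVneq (dotv u (reflectJ u)) 0.
  split; first by case: ifP.
  case: eqP => // qJ _ h Lh uh.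
  (* As [q] is on the boundary, J q lies in its own face, hence in the ray exposed by [u]; so both
     rays are the same. *)
  have uq := sub _ (lorentz_reflectJ Lq) qJ.
  have := lorentz_perp_ray (pos _ Lu un0) Lu (lorentz_reflectJ Lq) uq.
  rewrite reflectJ0 => eqJ; rewrite (lorentz_perp_ray (pos _ Lu un0) Lu Lh uh) dotvZr.
  have /eqP := qJ; rewrite eqJ dotvZr mulf_eq0 => /orP[|/eqP ->]; last by rewrite mulr0.
  by rewrite mulf_eq0 invr_eq0 !gt_eqF ?pos.
case: eqP => [qJ|qJn0].
  have /lorentz_cases[u0|_ uJ|d d0 Ld] := Lu; rewrite ?u0 ?uJ ?eqxx// in un0 uJn0.
  have := sub _ (lorentz_reflectJ Lq) qJ => /(lorentz_interior_perp d0 Ld (lorentz_reflectJ Lq)).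
  move=> /matrixP/(_ ord0 ord0); rewrite reflectJ0 mxE => q0.
  by have := pos _ Lq qn0; rewrite q0 ltxx.
split=> // _ h Lh uh.
have /lorentz_cases[u0|_ uJ|d d0 Ld] := Lu; rewrite ?u0 ?uJ ?eqxx// in un0 uJn0.
by rewrite (lorentz_interior_perp d0 Ld Lh uh) dotv0.
Qed.

End LorentzFaces.

(** * The product cone C *)

Section Pairing.
Variables (R : realType) (V : finType).
Implicit Types u h : vec R V.

Definition dota u h : R := \sum_c u c * h c.

Lemma dotaDl u h h' : dota (h + h') u = dota h u + dota h' u.
Proof. by rewrite -big_split; apply: eq_bigr => c _; rewrite ffunE mulrDl. Qed.

Lemma dotaZl a u h : dota (a *: h) u = a * dota h u.
Proof.
rewrite [RHS]big_distrr; apply: eq_bigr => c _.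
by rewrite ffunE; exact: (esym (mulrA _ _ _)).
Qed.

Lemma dotaC u h : dota u h = dota h u.
Proof. by apply: eq_bigr => c _; rewrite mulrC. Qed.

Lemma dotaDr u h h' : dota u (h + h') = dota u h + dota u h'.
Proof. by rewrite dotaC dotaDl !(dotaC u). Qed.

Lemma dotaZr a u h : dota u (a *: h) = a * dota u h.
Proof. by rewrite dotaC dotaZl (dotaC u). Qed.

Lemma dotaNl u h : dota (- h) u = - dota h u.
Proof. by rewrite -scaleN1r dotaZl mulN1r. Qed.

Lemma dotaBl u h h' : dota (h - h') u = dota h u - dota h' u.
Proof. by rewrite dotaDl dotaNl. Qed.

Lemma dot0a u : dota 0 u = 0.
Proof. by rewrite -(scale0r u) dotaZl mul0r. Qed.

Lemma dota_suml (I : finType) (f : I -> vec R V) u : dota (\sum_i f i) u = \sum_i dota (f i) u.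
Proof.
apply: (big_ind2 (fun v s => dota v u = s)) => [|v s w t <- <-|//]; first exact: dot0a.
exact: dotaDl.
Qed.

Lemma dota_unitv c u : dota (unitv R c) u = u c.
Proof.
rewrite /dota (bigD1 c)//= ffunE eqxx mul1r big1 ?addr0// => c' /negPf cc'.
by rewrite ffunE eq_sym cc' mul0r.
Qed.

Lemma dota_unitvD c c' u : dota (unitv R c + unitv R c') u = u c + u c'.
Proof. by rewrite dotaDl !dota_unitv. Qed.

Lemma dota_unitvB c c' u : dota (unitv R c - unitv R c') u = u c - u c'.
Proof. by rewrite dotaBl !dota_unitv. Qed.

Lemma dota_unitvBB c c' c'' u :
  dota (unitv R c - unitv R c' - unitv R c'') u = u c - u c' - u c''.
Proof. by rewrite dotaBl dota_unitvB dota_unitv. Qed.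

Lemma dota_unitvB_sum (I : finType) (f : I -> vec R V) c u :
  dota (unitv R c - \sum_i f i) u = u c - \sum_i dota (f i) u.
Proof. by rewrite dotaBl dota_unitv dota_suml. Qed.

Lemma dota_scale_unitv a c u : dota (a *: unitv R c) u = a * u c.
Proof. by rewrite dotaZl dota_unitv. Qed.

Lemma vec_subE u h c : (u - h) c = u c - h c.
Proof. by rewrite !ffunE. Qed.

Lemma scale_unitvE (a : R) (v w : V) : (a *: unitv R v) w = a * (v == w)%:R.
Proof. by rewrite !ffunE. Qed.

End Pairing.

Section Ambient.
Variables (R : realType) (F : socfmt).
Implicit Types u h y z q : ambient R F.

(** The half-line is the Lorentz cone of dimension 1, with empty tail, so one block argument serves
    both kinds of cone. *)
Lemma in_coneE (c : cone) (u : 'cV[R]_(cdim c)) : in_cone u = lorentz u.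
Proof. by case: c u => //= u; rewrite /lorentz big_ord0 sqrtr0. Qed.

Lemma inCP u : inC u <-> forall b, lorentz (blk u b).
Proof. by split=> Cu b; have := Cu b; rewrite in_coneE. Qed.

Lemma tan'P u z : tan' u z <-> forall b, btan (blk u b) (blk z b).
Proof.
split=> Tuz b; have [w [vp [vm [Lw Lp Lm]]]] := Tuz b.
  exists w, vp, vm; split=> //; first by rewrite -in_coneE.
    by move=> r; rewrite -in_coneE.
  by move=> r; rewrite -in_coneE.
exists w, vp, vm; split=> //; first by rewrite in_coneE.
  by move=> r; rewrite in_coneE.
by move=> r; rewrite in_coneE.
Qed.

Lemma dotaE u h : dota u h = \sum_b dotv (blk u b) (blk h b).
Proof.
rewrite /dota /dotv.
have -> : \sum_b \sum_a blk u b a ord0 * blk h b a ord0 =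
    \sum_(b : block F) \sum_(a : 'I_(cdim (bcone b)) | true) u (mkc a) * h (mkc a).
  by apply: eq_bigr => b _; apply: eq_bigr => a _; rewrite !mxE.
rewrite (sig_big_dep _ (fun _ _ => true) (fun b a => u (@mkc F b a) * h (@mkc F b a))) /=.
by apply: eq_bigr => -[b a] _.
Qed.

Lemma blkD u h b : blk (u + h) b = blk u b + blk h b.
Proof. by apply/matrixP => i j; rewrite !mxE ffunE. Qed.

Lemma blkZ a u b : blk (a *: u) b = a *: blk u b.
Proof. by apply/matrixP => i j; rewrite !mxE ffunE. Qed.

Lemma blkB u h b : blk (u - h) b = blk u b - blk h b.
Proof. by rewrite -scaleN1r blkD blkZ scaleN1r. Qed.

Lemma blk0 b : blk (0 : ambient R F) b = 0.
Proof. by apply/matrixP => i j; rewrite !mxE ffunE. Qed.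

Lemma blk_inj u h : (forall b, blk u b = blk h b) -> u = h.
Proof.
move=> eq_blk; apply/ffunP => -[b a].
by have /matrixP/(_ a ord0) := eq_blk b; rewrite !mxE.
Qed.

Definition of_blocks (G : forall b : block F, 'cV[R]_(cdim (bcone b))) : ambient R F :=
  [ffun c => G (tag c) (tagged c) ord0].

Lemma blk_of_blocks G b : blk (of_blocks G) b = G b.
Proof. by apply/matrixP => i j; rewrite (ord1 j) mxE ffunE. Qed.

(** Extension by zero. The sum has at most one term and avoids transporting [g] along an equality of
    blocks. *)
Definition of_block (b : block F) (g : 'cV[R]_(cdim (bcone b))) : ambient R F :=
  [ffun c => \sum_(a | mkc a == c) g a ord0].

Lemma blk_of_block b g : blk (@of_block b g) b = g.
Proof.
apply/matrixP => i j; rewrite (ord1 j) mxE ffunE (big_pred1 i)// => a.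
exact: (eq_Tagged (T_ := fun b : block F => 'I_(cdim (bcone b)))).
Qed.

Lemma blk_of_block_neq b b' g : b' != b -> blk (@of_block b g) b' = 0.
Proof.
move=> bb'; apply/matrixP => i j; rewrite !mxE ffunE big_pred0// => a.
by apply: contra_neqF bb' => /eqP /(congr1 (@tag _ _)) /=.
Qed.

Lemma dota_of_block u b g : dota u (@of_block b g) = dotv (blk u b) g.
Proof.
rewrite dotaE (bigD1 b)//= blk_of_block big1 ?addr0// => b' bb'.
by rewrite blk_of_block_neq// dotv0.
Qed.

Lemma inC0 : inC (0 : ambient R F).
Proof. by apply/inCP => b; rewrite blk0; exact: lorentz0. Qed.

Lemma inCD u h : inC u -> inC h -> inC (u + h).
Proof. by move=> /inCP Cu /inCP Ch; apply/inCP => b; rewrite blkD; exact: lorentzD. Qed.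

Lemma inCZ a u : 0 <= a -> inC u -> inC (a *: u).
Proof. by move=> a0 /inCP Cu; apply/inCP => b; rewrite blkZ; exact: lorentzZ. Qed.

Lemma inC_of_block b g : lorentz g -> inC (@of_block b g).
Proof.
move=> Lg; apply/inCP => b'; have [->|bb'] := eqVneq b' b; first by rewrite blk_of_block.
by rewrite blk_of_block_neq//; exact: lorentz0.
Qed.

Lemma inC_tau h : inC h -> 0 <= h (c_tau F).
Proof. by move=> /inCP/(_ b_tau)/lorentzP[]; rewrite mxE. Qed.

Lemma dota_ge0 u h : inC u -> inC h -> 0 <= dota u h.
Proof.
move=> /inCP Cu /inCP Ch; rewrite dotaE; apply: sumr_ge0 => b _.
exact: dot_lorentz_ge0.
Qed.

Lemma dota_eq0 u h : inC u -> inC h -> (dota u h = 0 <-> forall b, dotv (blk u b) (blk h b) = 0).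
Proof.
move=> /inCP Cu /inCP Ch; rewrite dotaE; split=> [/eqP|eq0]; last by rewrite big1.
rewrite psumr_eq0 => [/allP eq0 b|b _]; last exact: dot_lorentz_ge0.
by apply/eqP/eq0; rewrite mem_index_enum.
Qed.

Lemma tan'_perp u z h : inC u -> inC h -> tan' u z -> dota u h = 0 -> dota z h = 0.
Proof.
move=> Cu Ch /tan'P Tuz /(dota_eq0 Cu Ch) uh0; rewrite dotaE big1// => b _.
by move: Cu Ch => /inCP Cu /inCP Ch; exact: btan_perp (Tuz b) (uh0 b).
Qed.

Lemma tan'Z a u z : 0 <= a -> tan' u z -> tan' (a *: u) (a *: z).
Proof. by move=> a0 /tan'P Tuz; apply/tan'P => b; rewrite !blkZ; exact: btanZ. Qed.

(** At u = 0 the face is all of C, so z is orthogonal to C; pairing each block with N [apex] + z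
    leaves |z|^2 = 0. This recovers z_1 = 0 from the convention q_0 = 0. *)
Lemma tan'0 z : tan' 0 z -> z = 0.
Proof.
move=> /tan'P Tz; apply: blk_inj => b; have := Tz b; rewrite !blk0.
move: (blk z b) => {Tz}z Tz.
have perp g : lorentz g -> dotv z g = 0.
  by move=> Lh; apply: (btan_perp (lorentz0 _ _) Lh Tz); rewrite dot0v.
have [N _ /perp] := lorentz_apex_bound z.
rewrite dotvDr dotvZr perp ?mulr0 ?add0r//; last exact: lorentz_apex.
move=> /eqP; rewrite psumr_eq0 => [/allP z0|i _]; last by rewrite -expr2 sqr_ge0.
apply/matrixP => i j; rewrite (ord1 j) mxE; apply/eqP.
by rewrite -sqrf_eq0 expr2; apply: z0; rewrite mem_index_enum.
Qed.

(** Each block has its own multiplier, and their sum serves all blocks at once because [btan_weaken]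
    allows [u] to grow. *)
Lemma face_step u y : inC u -> (forall h, inC h -> dota u h = 0 -> 0 <= dota y h) ->
  exists M q z, [/\ 0 <= M, inC q, tan' (M *: u) z, y = q + z
    & forall h, inC h -> (dota q h = 0 <-> dota u h = 0 /\ dota y h = 0)].
Proof.
move=> Cu y_ge0.
(* A vector in one block's face, extended by zero, stays in the face of [u]; so [y] is nonnegative
   on every block face separately. *)
have y_ge0b b g : lorentz g -> dotv (blk u b) g = 0 -> 0 <= dotv (blk y b) g.
  by move=> Lg ug; rewrite -dota_of_block; apply: y_ge0;
    [exact: inC_of_block | rewrite dota_of_block].
have step b : exists t : R * 'cV[R]_(cdim (bcone b)) * 'cV[R]_(cdim (bcone b)),
    [/\ 0 <= t.1.1, lorentz t.1.2, btan (t.1.1 *: blk u b) t.2, blk y b = t.1.2 + t.2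
    & forall g, lorentz g ->
        (dotv t.1.2 g = 0 <-> dotv (blk u b) g = 0 /\ dotv (blk y b) g = 0)].
  move/inCP in Cu; have [M [q [z qz]]] := cone_step (Cu b) (y_ge0b b).
  by exists (M, q, z).
pose t b := sval (cid (step b)).
have tP b := svalP (cid (step b)); rewrite -/(t _) in tP.
pose q := of_blocks (fun b => (t b).1.2); pose z := of_blocks (fun b => (t b).2).
have Cq : inC q by apply/inCP => b; rewrite blk_of_blocks; case: (tP b).
have Mb_le b : (t b).1.1 <= \sum_b (t b).1.1.
  rewrite (bigD1 b)//= lerDl; apply: sumr_ge0 => b' _; by case: (tP b').
exists (\sum_b (t b).1.1), q, z; split=> //.
- by apply: sumr_ge0 => b _; case: (tP b).
- apply/tan'P => b; rewrite blkZ blk_of_blocks; have [M0 _ Tb _ _] := tP b.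
  rewrite -[\sum_b _](subrK (t b).1.1) addrC scalerDl; apply: btan_weaken => //.
  by apply: lorentzZ; [rewrite subr_ge0 | move/inCP: Cu].
- by apply: blk_inj => b; rewrite blkD !blk_of_blocks; case: (tP b).
move=> h Ch; have Lh b : lorentz (blk h b) by move/inCP: Ch.
split=> [/(dota_eq0 Cq Ch) qh|[/(dota_eq0 Cu Ch) uh yh]].
  have uyh b : dotv (blk u b) (blk h b) = 0 /\ dotv (blk y b) (blk h b) = 0.
    by have [_ _ _ _ tb] := tP b; apply/tb => //; rewrite -(blk_of_blocks (fun b => (t b).1.2)).
  split; first by apply/dota_eq0 => // b; case: (uyh b).
  by rewrite dotaE big1// => b _; case: (uyh b).
apply/dota_eq0 => // b; rewrite blk_of_blocks; have [_ _ _ _ tb] := tP b.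
apply/tb => //; split=> //; move: yh; rewrite dotaE => /eqP.
rewrite psumr_eq0 => [/allP yh|b' _]; last exact: y_ge0b.
by apply/eqP/yh; rewrite mem_index_enum.
Qed.

Lemma order_unit_face u : inC u -> exists f, [/\ inC f, dota u f = 0
  & forall h, inC h -> dota u h = 0 -> exists2 N, 0 <= N & inC (N *: f - h)].
Proof.
move=> Cu; have fP b := cid (face_order_unit ((inCP u).1 Cu b)).
pose f := of_blocks (fun b => sval (fP b)).
have fb b : blk f b = sval (fP b) by rewrite blk_of_blocks.
have Cf : inC f by apply/inCP => b; rewrite fb; case: (svalP (fP b)).
exists f; split=> //.
  by apply/(dota_eq0 Cu Cf) => b; rewrite fb; case: (svalP (fP b)).
move=> h Ch /(dota_eq0 Cu Ch) uh.
have NP b : exists N, 0 <= N /\ lorentz (N *: blk f b - blk h b).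
  rewrite fb; case: (svalP (fP b)) => _ _ /(_ _ ((inCP h).1 Ch b) (uh b))[N N0 LN].
  by exists N.
have [N {}NP] := choice NP.
have N_le b : N b <= \sum_b N b.
  by rewrite (bigD1 b)//= lerDl; apply: sumr_ge0 => b' _; case: (NP b').
exists (\sum_b N b); first by apply: sumr_ge0 => b _; case: (NP b).
apply/inCP => b; rewrite blkB blkZ -[\sum_b _](subrK (N b)) scalerDl -addrA.
apply: lorentzD; last by case: (NP b).
by apply: lorentzZ; [rewrite subr_ge0 | move/inCP: Cf].
Qed.

Definition ambient_rank u : nat := \sum_b face_rank (crank (bcone b)) (blk u b).

Lemma ambient_rank0 : ambient_rank 0 = rankC F.
Proof. by apply: eq_bigr => b _; rewrite /face_rank blk0 eqxx. Qed.

(** No block rank increases. If none decreased, all block faces would be unchanged and [h] would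
    still be orthogonal to [q]. *)
Lemma ambient_rank_lt u q h : inC u -> inC q ->
  (forall h, inC h -> dota q h = 0 -> dota u h = 0) ->
  inC h -> dota u h = 0 -> dota q h <> 0 -> (ambient_rank q < ambient_rank u)%N.
Proof.
move=> Cu Cq sub Ch uh qh.
have mono b := @face_rank_mono R _ (crank (bcone b)) (blk u b) (blk q b).
have subb b g : lorentz g -> dotv (blk q b) g = 0 -> dotv (blk u b) g = 0.
  move=> Lg qg; rewrite -dota_of_block; apply: sub; first exact: inC_of_block.
  by rewrite dota_of_block.
have {}mono b :
    (face_rank (crank (bcone b)) (blk q b) <= face_rank (crank (bcone b)) (blk u b))%N /\
    (face_rank (crank (bcone b)) (blk q b) = face_rank (crank (bcone b)) (blk u b) ->
     forall g, lorentz g -> dotv (blk u b) g = 0 -> dotv (blk q b) g = 0).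
  apply: mono; [by case: (bcone b)|by case: (bcone b)|by move/inCP: Cu|by move/inCP: Cq|].
  exact: subb.
rewrite ltn_neqAle; apply/andP; split; last by apply: leq_sum => b _; case: (mono b).
apply/eqP => eq_rk; apply: qh; apply/dota_eq0 => // b.
have [le_b eq_b] := mono b; apply: eq_b; last by exact: (dota_eq0 Cu Ch).1.
  apply/eqP; rewrite eqn_leq le_b /= leqNgt; apply/negP => lt_b.
  suff : (ambient_rank q < ambient_rank u)%N by rewrite eq_rk ltnn.
  rewrite /ambient_rank (bigD1 b)//= [X in (_ < X)%N](bigD1 b)//= -addSn.
  by apply: leq_add => //; apply: leq_sum => b' _; case: (mono b').
by move/inCP: Ch.
Qed.

End Ambient.

(** * Facial reduction *)

Section FacialReduction.
Variables (R : realType) (F : socfmt) (S : socsys R F).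
Implicit Types (u h y z q : ambient R F) (l eta : vec R (brow F)).

Lemma BmulE h r : Bmul S h r = dota (Bmat S r) h.
Proof. by rewrite ffunE. Qed.

Lemma dota_Btr l h : dota (Btr S l) h = \sum_r l r * Bmul S h r.
Proof. by rewrite dota_suml; apply: eq_bigr => r _; rewrite dotaZl BmulE. Qed.

Lemma dota_Btr_ker l h : Bmul S h = 0 -> dota (Btr S l) h = 0.
Proof. by move=> Bh; rewrite dota_Btr Bh big1// => r _; rewrite ffunE mulr0. Qed.

Lemma BmulD h h' : Bmul S (h + h') = Bmul S h + Bmul S h'.
Proof. by apply/ffunP => r; rewrite [RHS]ffunE !BmulE dotaDr. Qed.

Lemma BmulZ a h : Bmul S (a *: h) = a *: Bmul S h.
Proof. by apply/ffunP => r; rewrite [RHS]ffunE !BmulE dotaZr. Qed.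

Lemma Btr0 : Btr S 0 = 0.
Proof. by apply: big1 => r _; rewrite ffunE scale0r. Qed.

Lemma BtrZ a l : Btr S (a *: l) = a *: Btr S l.
Proof. by rewrite scaler_sumr; apply: eq_bigr => r _; rewrite ffunE -scalerA. Qed.

Lemma dota_tau eta h :
  dota (- unitv R (c_tau F) - Btr S eta) h = - h (c_tau F) - dota (Btr S eta) h.
Proof. by rewrite dotaDl !dotaNl dota_unitv. Qed.

(** Membership of [y] in the dual cone of the face exposed by [u]. *)
Definition on_face u y : Prop := forall h, inC h -> dota u h = 0 -> 0 <= dota y h.

(* The cone { (B h, h_tau - s) : h in the face of u, s >= 0 } has the order unit
   (B f, f_tau - 1), with f an order unit of the face; its negative lies in the cone
   only if B (h + f) = 0 with (h + f)_tau = s + 1 > 0.  A positive functional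
   (lambda, mu) has mu <= 0: it certifies h_tau <= 0 on the face if mu < 0, and cuts
   the face strictly if mu = 0. *)
Lemma facial_alternative u :
  (forall h, Hset S h -> h (c_tau F) = 0) -> inC u ->
  (exists eta, on_face u (- unitv R (c_tau F) - Btr S eta)) \/
  (exists2 l, on_face u (Btr S l)
     & exists f, [/\ inC f, dota u f = 0 & 0 < dota (Btr S l) f]).
Proof.
move=> tau0 Cu; have [f [Cf uf ouf]] := order_unit_face Cu.
pose W : lmodType R := (vec R (brow F) * R^o)%type.
pose img h (s : R) : W := (Bmul S h, h (c_tau F) - s).
have imgD h s h' s' : img h s + img h' s' = img (h + h') (s + s').
  by rewrite /img BmulD [(h + h') _]ffunE opprD addrACA.
have imgZ a h s : a *: img h s = img (a *: h) (a * s).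
  by rewrite /img BmulZ [(a *: h) _]ffunE -[a * s]/(a *: (s : R^o)) -scalerBr.
pose K : set W := [set v | exists h s, [/\ inC h, dota u h = 0, 0 <= s & v = img h s]]%classic.
have uK : unit_cone (img f 1) K.
  split.
  - split=> [_ _ [h [s [Ch uh s0 ->]]] [h' [s' [Ch' uh' s0' ->]]]|a _ a0 [h [s [Ch uh s0 ->]]]].
      exists (h + h'), (s + s'); rewrite imgD dotaDr uh uh' !addr0 addr_ge0//.
      by split=> //; exact: inCD.
    exists (a *: h), (a * s); rewrite imgZ dotaZr uh mulr0 mulr_ge0//.
    by split=> //; exact: inCZ.
  - move=> _ [h [s [Ch uh s0 ->]]]; have [N N0 CN] := ouf h Ch uh.
    exists (N + s), ((N + s) *: f - h), N; split.
    + rewrite scalerDl addrAC; apply: inCD => //; exact: inCZ.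
    + by rewrite -scaleN1r dotaDr !dotaZr uf uh !mulr0 addr0.
    + by [].
    by rewrite imgZ -scaleN1r imgZ imgD scaleN1r mulr1 mulN1r addrK.
  - by exists f, 1.
  - move=> [h [s [Ch uh s0]]]; rewrite -scaleN1r imgZ /img => -[/eqP Bf tauf].
    have Hhf : Hset S (h + f).
      split; last exact: inCD.
      by rewrite BmulD -(eqP Bf) -BmulD scaleN1r addNr -(scale0r 0) BmulZ scale0r.
    have := tau0 _ Hhf; rewrite ffunE; move: tauf; rewrite ffunE => tauf.
    have -> : h (c_tau F) = 1 - f (c_tau F) + s.
      have := tauf; rewrite -[_ *: _]/(-1 * f (c_tau F)) => e.
      by apply: (addIr (- s)); rewrite -e addrK; ring.
    lra.
have [phi [phiD phiZ phi_ge0 phi1]] := unit_cone_functional uK.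
have phi0 : phi 0 = 0 by rewrite -(scale0r 0) phiZ mul0r.
pose l : vec R (brow F) := [ffun r => phi (unitv R r, 0)].
pose mu := phi (0, 1).
have phiE h s : phi (img h s) = dota (Btr S l) h + mu * (h (c_tau F) - s).
  have -> : img h s = (\sum_r Bmul S h r *: ((unitv R r, 0) : W))
      + (h (c_tau F) - s) *: ((0, 1) : W).
    apply: injective_projections.
      rewrite [RHS]/= raddf_sum /= scaler0 addr0; apply/ffunP => r.
      rewrite sum_ffunE (bigD1 r)//= scale_unitvE eqxx.
      rewrite [X in _ + X]big1 ?addr0; first by rewrite mulr1.
      by move=> r' /negPf rr'; rewrite scale_unitvE rr' mulr0.
    rewrite [RHS]/= raddf_sum /= big1 ?add0r; first by exact: (esym (mulr1 _)).
    by move=> r _; exact: mulr0.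
  rewrite phiD phiZ dota_Btr [_ * mu]mulrC; congr (_ + _).
  rewrite (big_morph phi phiD phi0); apply: eq_bigr => r _.
  by rewrite phiZ mulrC [l r]ffunE.
have mu_le0 : mu <= 0.
  have : 0 <= phi (img 0 1).
    apply: phi_ge0; exists 0, 1; split=> //; first exact: inC0.
    by rewrite -(scale0r 0) dotaZr mul0r.
  have B0 : Bmul S 0 = 0 by rewrite -(scale0r 0) BmulZ scale0r.
  by rewrite phiE dota_Btr_ker// add0r ffunE sub0r mulrN1 oppr_ge0.
have l_ge0 h : inC h -> dota u h = 0 -> 0 <= dota (Btr S l) h + mu * h (c_tau F).
  move=> Ch uh; have := phiE h 0; rewrite subr0 => <-; apply: phi_ge0.
  by exists h, 0.
have [mu0|mun0] := eqVneq mu 0.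
  right; exists l => [h Ch uh|]; first by have := l_ge0 h Ch uh; rewrite mu0 mul0r addr0.
  by exists f; split=> //; move: phi1; rewrite phiE mu0 mul0r addr0 => ->.
(* Dividing the inequality [l_ge0] by mu < 0 normalises the coefficient of h_tau to - 1. *)
left; exists (mu^-1 *: l) => h Ch uh; rewrite dota_tau BtrZ dotaZl.
have mu_lt0 : mu < 0 by rewrite lt_neqAle mun0.
rewrite -(nmulr_rle0 _ mu_lt0) mulrBr mulrA divff// mul1r mulrN.
by have := l_ge0 h Ch uh; lra.
Qed.

End FacialReduction.

(** * Chains of face reductions and solutions of the system *)

Section Certificate.
Variables (R : realType) (F : socfmt) (S : socsys R F).
Local Notation T := (rankC F).
Implicit Types (u h x : ambient R F) (n : nat).

Definition before (q : nat -> ambient R F) n : ambient R F := if n is m.+1 then q m else 0.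

(* With the convention q_0 = 0, the condition z_1 = 0 reads z_1 \in tan'(q_0). *)
Definition chain n (y q z : nat -> ambient R F) : Prop :=
  forall j, (j < n)%N -> [/\ y j = q j + z j, inC (q j) & tan' (before q j) (z j)].

Local Notation app n a f x := (fun j => if (j < n)%N then a *: f j else x).

Lemma before_inC n y q z : chain n y q z -> inC (before q n).
Proof. by case: n => [_|n ch]; [exact: inC0 | have [_ Cq _] := ch n (ltnSn n)]. Qed.

(** The earlier chain absorbs the multiplier M, while [x] enters unscaled. The new face is described
    through the old [q], so that M = 0 does no harm. *)
Lemma chain_extend n y q z x : chain n y q z -> on_face (before q n) x ->
  exists M q' z', [/\ chain n.+1 (app n M y x) q' z'
    & forall h, inC h -> (dota (q' n) h = 0 <-> dota (before q n) h = 0 /\ dota x h = 0)].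
Proof.
move=> ch x_ge0; have [M [Q [Z [M0 CQ TZ xQZ Qface]]]] := face_step (before_inC ch) x_ge0.
exists M, (app n M q Q), (app n M z Z); split=> [j|h Ch]; last by rewrite ltnn; exact: Qface.
have before_app : forall i, (i <= n)%N -> before (app n M q Q) i = M *: before q i.
  by case=> [|i] /= lt_in; rewrite ?scaler0 ?lt_in.
rewrite ltnS leq_eqVlt => /predU1P[->|lt_jn].
  by rewrite ltnn before_app//; split.
rewrite lt_jn before_app 1?ltnW//; have [-> Cq Tz] := ch j lt_jn.
by split; [rewrite scalerDr | exact: inCZ | exact: tan'Z].
Qed.

Lemma frakN_sol_sound eta lam y q z h :
  @frakN_sol R F S eta lam y q z -> Hset S h -> h (c_tau F) = 0.
Proof.
move=> [y_lam y_last yqz z0 Tz] [Bh Ch].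
have z_perp m (lt_mT : (m < T.+1)%N) : dota (z (Ordinal lt_mT)) h = 0.
  elim: m lt_mT => [|m IHm] lt_mT.
    by rewrite (_ : Ordinal _ = ord0) ?z0 ?dot0a//; exact: val_inj.
  pose j := Ordinal (lt_mT : (m < T)%N).
  have -> : Ordinal lt_mT = osnd j by exact: val_inj.
  have [yE Cq] := yqz (ofst j); apply: (tan'_perp Cq Ch (Tz j)).
  have := dota_Btr_ker (lam j) Bh; rewrite -y_lam yE dotaDl.
  have -> : ofst j = Ordinal (ltnW lt_mT) by exact: val_inj.
  by rewrite IHm addr0.
have [y_max Cq] := yqz ord_max.
have := dota_ge0 Cq Ch; have : dota (y ord_max) h = dota (q ord_max) h.
  by rewrite y_max dotaDl (z_perp _ (ltnSn T) : dota (z ord_max) h = 0) addr0.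
rewrite y_last dota_tau dota_Btr_ker// subr0 => <-; rewrite oppr_ge0 => le0.
by apply/eqP; rewrite eq_le le0 inC_tau.
Qed.

Definition certified u : Prop := exists eta, on_face u (- unitv R (c_tau F) - Btr S eta).

(** The invariant trades steps for rank: as long as no certificate exists, each step cuts the face
    strictly, so n steps have used up at least n of the T ranks. *)
Lemma facial_chain : (forall h, Hset S h -> h (c_tau F) = 0) ->
  forall n, exists y q z, [/\ chain n y q z, forall j, (j < n)%N -> exists l, y j = Btr S l
    & certified (before q n) \/ (ambient_rank (before q n) + n <= T)%N].
Proof.
move=> tau0; elim=> [|n [y [q [z [ch y_lam le_T]]]]].
  exists (fun=> 0), (fun=> 0), (fun=> 0); split=> //.
  by right; rewrite /= ambient_rank0 addn0.
have extend l : on_face (before q n) (Btr S l) ->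
    exists y q' z', [/\ chain n.+1 y q' z', forall j, (j < n.+1)%N -> exists l, y j = Btr S l
    & forall h, inC h -> (dota (q' n) h = 0 <-> dota (before q n) h = 0 /\ dota (Btr S l) h = 0)].
  move=> l_ge0; have [M [q' [z' [ch' q'P]]]] := chain_extend ch l_ge0.
  exists (app n M y (Btr S l)), q', z'; split=> // j _.
  case: ifP => [lt_jn|_]; last by exists l.
  by have [l' ->] := y_lam j lt_jn; exists (M *: l'); rewrite BtrZ.
have [[eta eta_ge0]|[l l_ge0 [f [Cf uf lf]]]] := facial_alternative tau0 (before_inC ch).
  (* A certificate is already present: padding with y = 0 leaves the face unchanged and keeps it
     valid. *)
  have [|y' [q' [z' [ch' y'_lam q'P]]]] := extend 0.
    by move=> h _ _; rewrite Btr0 dot0a.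
  exists y', q', z'; split=> //; left; exists eta => h Ch q'h.
  by apply: eta_ge0 => //; case: ((q'P h Ch).1 q'h).
have [y' [q' [z' [ch' y'_lam q'P]]]] := extend l l_ge0.
exists y', q', z'; split=> //.
case: le_T => [[eta eta_ge0]|le_T]; [left; exists eta => h Ch q'h|right].
  by apply: eta_ge0 => //; case: ((q'P h Ch).1 q'h).
rewrite addnS; apply: leq_trans le_T; rewrite ltn_add2r.
apply: (ambient_rank_lt (h := f)) => //.
- exact: before_inC ch.
- exact: before_inC ch'.
- by move=> h Ch q'h; case: ((q'P h Ch).1 q'h).
- by move=> /(q'P f Cf).1[_ lf0]; rewrite lf0 ltxx in lf.
Qed.

Lemma frakN_sol_complete : (forall h, Hset S h -> h (c_tau F) = 0) ->
  exists eta lam y q z, @frakN_sol R F S eta lam y q z.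
Proof.
move=> tau0; have [y [q [z [ch y_lam cert]]]] := facial_chain tau0 T.
have [eta eta_ge0] : certified (before q T).
  (* Otherwise all T ranks are spent and the face has rank 0; a further strict cut would lower it
     again, so the alternative yields the certificate. *)
  case: cert => // rk0.
  have [//|[l l_ge0 [f [Cf uf lf]]]] := facial_alternative tau0 (before_inC ch).
  have [M [q' [z' [ch' q'P]]]] := chain_extend ch l_ge0.
  suff : (ambient_rank (q' T) < ambient_rank (before q T))%N.
    by move: rk0; rewrite -[X in (_ <= X)%N]add0n leq_add2r leqn0 => /eqP ->.
  apply: (ambient_rank_lt (h := f)) => //.
  - exact: before_inC ch.
  - exact: before_inC ch'.
  - by move=> h Ch q'h; case: ((q'P h Ch).1 q'h).
  - by move=> /(q'P f Cf).1[_ lf0]; rewrite lf0 ltxx in lf.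
(* The certificate is appended as y_(T+1); this rescales the multipliers [lam] by M but not the
   certificate. *)
have [M [q' [z' [ch' _]]]] := chain_extend ch eta_ge0.
have [lam lamP] := choice (fun j : 'I_T => y_lam j (ltn_ord j)).
exists eta, (fun j => M *: lam j), (fun j => app T M y (- unitv R (c_tau F) - Btr S eta) j),
  (fun j => q' j), (fun j => z' j); split.
- by move=> j; rewrite /= ltn_ord BtrZ lamP.
- by rewrite /= ltnn.
- by move=> j; have [-> Cq _] := ch' j (ltn_ord j).
- by apply: tan'0; have [_ _] := ch' 0 (ltn0Sn T).
- by move=> j; have [_ _] := ch' j.+1 (ltn_ord (osnd j)).
Qed.

End Certificate.

(** * Homogenization *)

Section Homogenization.
Variables (R : realType) (F : socfmt) (S : socsys R F).

Lemma Bmul_s h i (a : 'I_(fp i).+2) :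
  Bmul S h (r_s a) = h (c_s a) - \sum_j sD S i a j * (h (c_xp j) - h (c_xm j))
    - sd S i a ord0 * h (c_tau F).
Proof.
rewrite BmulE !dotaBl dotaZl dota_suml !dota_unitv; congr (_ - _ - _).
by apply: eq_bigr => j _; rewrite dotaZl dotaBl !dota_unitv.
Qed.

Lemma Bmul_E h l :
  Bmul S h (r_E l) = \sum_j sE S l j * (h (c_xp j) - h (c_xm j)) - sf S l ord0 * h (c_tau F).
Proof.
rewrite BmulE !dotaBl dotaZl dota_suml !dota_unitv; congr (_ - _).
by apply: eq_bigr => j _; rewrite dotaZl dotaBl !dota_unitv.
Qed.

(** A point of the solution set lifts to tau = 1 through positive and negative parts; conversely a
    member with tau > 0 yields a point after division by tau. *)
Lemma homogenization :
  (forall h, Hset S h -> h (c_tau F) = 0) <-> solset S = set0.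
Proof.
split=> [tau0|sol0 h [Bh Ch]].
  rewrite -subset0 => x [Lx Ex].
  pose G (b : block F) : 'cV[R]_(cdim (bcone b)) :=
    match b with
    | b_tau => const_mx 1
    | b_xp j => const_mx (Num.max (x j ord0) 0)
    | b_xm j => const_mx (Num.max (- x j ord0) 0)
    | b_s i => sD S i *m x + sd S i
    end.
  pose h := of_blocks G.
  have xE j : h (c_xp j) - h (c_xm j) = x j ord0.
    by rewrite !ffunE /= !mxE !maxEle; case: (leP (x j ord0) 0); case: (leP (- x j ord0) 0); lra.
  have tauE : h (c_tau F) = 1 by rewrite ffunE mxE.
  have : h (c_tau F) = 0; last by rewrite tauE => /eqP; rewrite oner_eq0.
  apply: tau0; split.
    apply/ffunP => -[i a|l]; rewrite [RHS]ffunE ?Bmul_s ?Bmul_E tauE mulr1.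
      rewrite [h _]ffunE /= !mxE; under [X in _ - X - _]eq_bigr do rewrite xE.
      by rewrite addrAC addrK subrr.
    under eq_bigr do rewrite xE.
    by have /matrixP/(_ l ord0) := Ex; rewrite mxE => ->; rewrite subrr.
  apply/inCP => b; rewrite blk_of_blocks -in_coneE; case: b => [|j|j|i] //=.
  - by rewrite mxE.
  - by rewrite mxE le_max lexx orbT.
  - by rewrite mxE le_max lexx orbT.
apply: contrapT => tau_n0.
have tau_gt0 : 0 < h (c_tau F) by rewrite lt_neqAle eq_sym inC_tau// andbT; exact/eqP.
pose x : 'cV[R]_(fd F) := \col_j ((h (c_xp j) - h (c_xm j)) / h (c_tau F)).
have DxE m (A : 'M[R]_(m, fd F)) i :
    (A *m x) i ord0 = (\sum_j A i j * (h (c_xp j) - h (c_xm j))) / h (c_tau F).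
  by rewrite mxE big_distrl; apply: eq_bigr => j _; rewrite mxE mulrA.
have : solset S x; last by rewrite sol0.
split=> [i|].
  have -> : sD S i *m x + sd S i = (h (c_tau F))^-1 *: blk h (b_s i).
    apply/matrixP => a j; rewrite (ord1 j) mxE DxE 2!mxE.
    have := congr1 (fun v : vec R (brow F) => v (r_s a)) Bh; rewrite /= Bmul_s ffunE.
    move=> /eqP; rewrite subr_eq add0r subr_eq => /eqP hs.
    by rewrite [X in _ = _ * X]hs; field; rewrite gt_eqF.
  apply: lorentzZ; first by rewrite invr_ge0 ltW.
  exact: (inCP h).1 Ch (b_s i).
apply/matrixP => l j; rewrite (ord1 j) DxE.
have := congr1 (fun v : vec R (brow F) => v (r_E l)) Bh; rewrite /= Bmul_E ffunE.
by move=> /eqP; rewrite subr_eq0 => /eqP ->; rewrite mulfK// gt_eqF.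
Qed.

End Homogenization.

(** * Solutions of the flattened system *)

Section SystemSemantics.
Variables (R : realType).

Lemma mksoc_feasible (V I Q : finType) (p : I -> nat)
    (D : forall i, 'I_(p i).+2 -> vec R V) (d : forall i, 'I_(p i).+2 -> R)
    (E : Q -> vec R V) (f : Q -> R) :
  feasible (mksoc D d E f) <-> exists v : vec R V,
    (forall i, lorentz (\col_a (dota (D i a) v + d i a))) /\ (forall l, dota (E l) v = f l).
Proof.
have dotE (w : vec R V) (x : 'cV[R]_#|V|) (v : vec R V) : (forall j, v (enum_val j) = x j ord0) ->
    \sum_j w (enum_val j) * x j ord0 = dota w v.
  move=> vx; rewrite /dota (reindex _ (onW_bij _ (@enum_val_bij V))).
  by apply: eq_bigr => j _; rewrite -vx.
have colE (i : 'I_#|I|) (x : 'cV[R]_#|V|) (v : vec R V) : (forall j, v (enum_val j) = x j ord0) ->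
    sD (mksoc D d E f) i *m x + sd (mksoc D d E f) i =
    \col_a (dota (D (enum_val i) a) v + d (enum_val i) a).
  move=> vx; apply/matrixP => a j; rewrite (ord1 j) !mxE -(dotE _ x)//; congr (_ + _).
  by apply: eq_bigr => k _; rewrite mxE.
have rowE (x : 'cV[R]_#|V|) (v : vec R V) l : (forall j, v (enum_val j) = x j ord0) ->
    (sE (mksoc D d E f) *m x) l ord0 = dota (E (enum_val l)) v.
  by move=> vx; rewrite mxE -(dotE _ x)//; apply: eq_bigr => k _; rewrite mxE.
split=> [[x [Lx Ex]]|[v [Lv Ev]]].
  pose v : vec R V := [ffun w => x (enum_rank w) ord0].
  have vx j : v (enum_val j) = x j ord0 by rewrite ffunE enum_valK.
  exists v; split=> [i|l].
    by rewrite -(enum_rankK i) -(colE _ x v vx); exact: Lx.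
  by rewrite -(enum_rankK l) -(rowE x v _ vx) Ex mxE.
pose x : 'cV[R]_#|V| := \col_j v (enum_val j).
have vx j : v (enum_val j) = x j ord0 by rewrite mxE.
exists x; split=> [i|]; first by rewrite (colE i x v vx); exact: Lv.
by apply/matrixP => l j; rewrite (ord1 j) (rowE x v l vx) Ev mxE.
Qed.

Lemma lorentz_lrows (V : finType) (c : cone) (g : 'I_(cdim c) -> vec R V) (v : vec R V) :
  lorentz (\col_a (dota (lrows g a) v + 0)) = lorentz (\col_a dota (g a) v).
Proof.
case: c g => [|p] g; last by congr lorentz; apply/matrixP => a j; rewrite !mxE addr0.
apply/lorentzP/lorentzP; rewrite /tail_dot big_ord0 big_ord1 !mxE /= dot0a !addr0 mulr0.
  by case=> g0 _; split=> //; exact: sqr_ge0.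
by case=> g0 _; split=> //; exact: sqr_ge0.
Qed.

Variables (F : socfmt) (S : socsys R F).
Local Notation T := (rankC F).

(** [neq_lhs] evaluated at a plain function, so that each equation can be read off by
    computation. *)
Definition neqn_value (v : nvar F -> R) (l : neqn F) : R :=
  match l with
  | q_y j c => v (v_y (ofst j) c) - \sum_r Bmat S r c * v (v_lam j r)
  | q_ylast c => v (v_y ord_max c) + \sum_r Bmat S r c * v (v_eta r)
  | q_sum j c => v (v_y j c) - v (v_q j c) - v (v_z j c)
  | q_z0 c => v (v_z ord0 c)
  | q_tanu j (existT b a) =>
      v (v_q (ofst j) (mkc a)) - v (v_w j (mkc a))
      - \sum_r (v (v_v j true r a) + v (v_v j false r a))
  | q_tanz j (existT b a) =>
      v (v_z (osnd j) (mkc a))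
      - \sum_(r : ridx (cdim (bcone b))) \sum_a'
          Rmx R r a a' * (v (v_v j true r a') - v (v_v j false r a'))
  end.

Lemma dota_neq_lhs l (v : vec R (nvar F)) : dota (neq_lhs S l) v = neqn_value v l.
Proof.
case: l => [j c|c|j c|c|j [b a]|j [b a]] /=.
- by rewrite dota_unitvB_sum; congr (_ - _); apply: eq_bigr => r _; rewrite dota_scale_unitv.
- rewrite dotaDl dota_unitv dota_suml; congr (_ + _); apply: eq_bigr => r _.
  by rewrite dota_scale_unitv.
- by rewrite dota_unitvBB.
- by rewrite dota_unitv.
- rewrite dotaBl dota_unitvB dota_suml; congr (_ - _); apply: eq_bigr => r _.
  by rewrite dota_unitvD.
- rewrite dota_unitvB_sum; congr (_ - _); apply: eq_bigr => r _.
  by rewrite dota_suml; apply: eq_bigr => a' _; rewrite dotaZl dota_unitvB.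
Qed.

Lemma frakN_feasible : feasible (frakN S) <-> exists v : nvar F -> R,
  (forall i : ncone F, lorentz (\col_a v (ncvar (i := i) a))) /\
  (forall l, neqn_value v l = neq_rhs R l).
Proof.
have colE (v : vec R (nvar F)) (i : ncone F) :
    \col_a v (ncvar (i := i) a) = \col_a dota (unitv R (ncvar (i := i) a)) v.
  by apply/matrixP => a j; rewrite !mxE dota_unitv.
split=> [/mksoc_feasible[v [Lv Ev]]|[v [Lv Ev]]].
  exists v; split=> [i|l]; last by rewrite -dota_neq_lhs.
  by rewrite colE -lorentz_lrows; exact: Lv.
apply/mksoc_feasible; exists [ffun w => v w].
have vE : [ffun w => v w] =1 v by move=> w; rewrite ffunE.
split=> [i|l].
  rewrite lorentz_lrows -colE; suff -> : \col_a [ffun w => v w] (ncvar (i := i) a) =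
     \col_a v (ncvar (i := i) a) by exact: Lv.
  by apply/matrixP => a j; rewrite !mxE vE.
by rewrite dota_neq_lhs -Ev; congr neqn_value; exact/funext.
Qed.

Lemma BtrE (l : vec R (brow F)) c : Btr S l c = \sum_r Bmat S r c * l r.
Proof.
rewrite sum_ffunE; apply: eq_bigr => r _; rewrite ffunE; exact: mulrC.
Qed.

Lemma frakN_feasibleP : feasible (frakN S) <->
  exists eta lam y q z, @frakN_sol R F S eta lam y q z.
Proof.
split=> [/frakN_feasible[v [Lv Ev]]|[eta [lam [y [q [z [y_lam y_last yqz z0 Tz]]]]]]].
  pose y j : ambient R F := [ffun c => v (v_y j c)].
  pose q j : ambient R F := [ffun c => v (v_q j c)].
  pose z j : ambient R F := [ffun c => v (v_z j c)].
  exists [ffun r => v (v_eta r)], (fun j => [ffun r => v (v_lam j r)]), y, q, z; split.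
  - move=> j; apply/ffunP => c; rewrite ffunE BtrE; under eq_bigr do rewrite ffunE.
    by apply/eqP; rewrite -subr_eq0; apply/eqP/(Ev (q_y j c)).
  - apply/ffunP => c; rewrite ffunE [RHS]ffunE [(- unitv R _) c]ffunE [(- Btr _ _) c]ffunE BtrE.
    under eq_bigr do rewrite ffunE.
    by have := Ev (q_ylast c) => /= <-; rewrite addrK.
  - move=> j; split.
      apply/ffunP => c; rewrite !ffunE; apply/eqP.
      by rewrite -subr_eq0 opprD addrA; apply/eqP/(Ev (q_sum j c)).
    apply/inCP => b; have := Lv (k_q j b); congr (is_true (lorentz _)).
    by apply/matrixP => a i; rewrite !mxE ffunE.
  - by apply/ffunP => c; rewrite !ffunE; exact: (Ev (q_z0 c)).
  - move=> j; apply/tan'P => b.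
    exists (\col_a v (v_w j (mkc a))), (fun r => \col_a v (v_v j true r a)),
      (fun r => \col_a v (v_v j false r a)); split.
    + exact: (Lv (k_w j b)).
    + by move=> r; exact: (Lv (k_v j true r)).
    + by move=> r; exact: (Lv (k_v j false r)).
    + apply/matrixP => a i; rewrite (ord1 i) !mxE ffunE summxE; apply/eqP.
      rewrite -subr_eq0 opprD addrA; apply/eqP; rewrite -[RHS](Ev (q_tanu j (mkc a))) /=.
      by congr (_ - _); apply: eq_bigr => r _; rewrite !mxE.
    + apply/matrixP => a i; rewrite (ord1 i) !mxE ffunE summxE; apply/eqP.
      rewrite -subr_eq0; apply/eqP; rewrite -[RHS](Ev (q_tanz j (mkc a))) /=.
      congr (_ - _); apply: eq_bigr => r _; rewrite mxE; apply: eq_bigr => a' _.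
      by rewrite !mxE.
(* The witnesses for all steps and blocks are chosen simultaneously, with v^+ and v^- packed into
   one family indexed by the sign as in [v_v]. *)
have aux j b : exists t : 'cV[R]_(cdim (bcone b)) *
    (bool -> ridx (cdim (bcone b)) -> 'cV[R]_(cdim (bcone b))),
    [/\ lorentz t.1, forall s r, lorentz (t.2 s r),
        blk (q (ofst j)) b = t.1 + \sum_r (t.2 true r + t.2 false r)
      & blk (z (osnd j)) b = \sum_r Rmx R r *m (t.2 true r - t.2 false r)].
  have [w [vp [vm [Lw Lp Lm qE zE]]]] := (tan'P _ _).1 (Tz j) b.
  by exists (w, fun s => if s then vp else vm); split=> // -[].
pose t j b := sval (cid (aux j b)).
have tP j b := svalP (cid (aux j b)); rewrite -/(t _ _) in tP.
pose v (x : nvar F) : R := match x with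
  | v_eta r => eta r
  | v_lam j r => lam j r
  | v_y j c => y j c
  | v_q j c => q j c
  | v_z j c => z j c
  | v_w j c => (t j (tag c)).1 (tagged c) ord0
  | v_v j s b r a => (t j b).2 s r a ord0
  end.
have col_id m (g : 'cV[R]_m) : \col_a g a ord0 = g.
  by apply/matrixP => a i; rewrite (ord1 i) mxE.
apply/frakN_feasible; exists v; split=> [[j b|j b|j s b r]|] /=.
- by have [_ /inCP/(_ b)] := yqz j.
- by rewrite col_id; case: (tP j b).
- by rewrite col_id; case: (tP j b).
case=> [j c|c|j c|c|j [b a]|j [b a]] /=.
- by rewrite y_lam BtrE subrr.
- by rewrite y_last vec_subE BtrE subrK ffunE.
- by have [-> _] := yqz j; rewrite ffunE; ring.
- by rewrite z0 ffunE.
- have [_ _ /matrixP/(_ a ord0) qE _] := tP j b; move: qE.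
  rewrite !mxE summxE => ->; rewrite [X in X - _]addrAC subrr add0r.
  apply/eqP; rewrite subr_eq0; apply/eqP.
  by apply: eq_bigr => r _; rewrite mxE.
- have [_ _ _ /matrixP/(_ a ord0)] := tP j b.
  rewrite !mxE summxE => ->; apply/eqP; rewrite subr_eq0; apply/eqP; apply: eq_bigr => r _.
  by rewrite mxE; apply: eq_bigr => a' _; rewrite !mxE.
Qed.

End SystemSemantics.

(** * Symbolic coefficients *)

Section Template.
Variables (R : realType) (F : socfmt).
Local Notation T := (rankC F).

Definition signs : seq rat := [:: 0; 1; -1].

(** An entry of the system is viewed as a function of the data; the quantifier order makes one
    coefficient serve all data at once. *)
Definition symbolic (f : socsys R F -> R) : Prop :=
  exists2 c : coef F, c.1 \in signs & forall S, f S = ceval S c.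

Lemma symbolic_const f x : (forall S, f S = x) -> x \in [:: 0; 1; -1] -> symbolic f.
Proof.
move=> fx; rewrite !inE => /or3P[] /eqP xE.
- by exists (0, None) => [|S]; rewrite ?inE// fx xE /ceval /= rmorph0 mul0r.
- by exists (1, None) => [|S]; rewrite ?inE// fx xE /ceval /= rmorph1 mul1r.
- by exists (-1, None) => [|S]; rewrite ?inE ?orbT// fx xE /ceval /= rmorphN1 mulr1.
Qed.

Lemma symbolic_entry f p : (forall S, f S = dentry S p) -> symbolic f.
Proof.
by move=> fp; exists (1, Some p) => [|S]; rewrite ?inE// fp /ceval /= rmorph1 mul1r.
Qed.

Lemma symbolicN f : symbolic f -> symbolic (fun S => - f S).
Proof.
move=> [[x o] xK fE]; exists (- x, o) => [|S] /=; last by rewrite fE /ceval /= rmorphN mulNr.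
by move: xK; rewrite !inE /= => /or3P[] /eqP ->; rewrite ?oppr0 ?opprK ?eqxx ?orbT.
Qed.

Lemma symbolic_ext f g : (forall S, f S = g S) -> symbolic g -> symbolic f.
Proof. by move=> fg [c cK gE]; exists c => // S; rewrite fg. Qed.

(** Injectivity lets each variable occur in at most one term, so no coefficient is ever a sum of
    several data entries. *)
Lemma sum_unitv (V I : finType) (k : I -> V) (w : V) : injective k ->
  (exists2 i, w = k i & forall g : I -> R, \sum_i g i * unitv R (k i) w = g i) \/
  (forall g : I -> R, \sum_i g i * unitv R (k i) w = 0).
Proof.
move=> k_inj; have [i /eqP kw|kw] := pickP (fun i => k i == w).
  left; exists i => // g; rewrite (bigD1 i)//= ffunE kw eqxx mulr1 big1 ?addr0// => i' ii'.
  by rewrite ffunE -kw (inj_eq k_inj) (negPf ii') mulr0.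
by right=> g; apply: big1 => i _; rewrite ffunE kw mulr0.
Qed.

Lemma unitv_neq (V : finType) (v w : V) : v <> w -> unitv R v w = 0.
Proof. by move=> /eqP/negPf vw; rewrite ffunE vw. Qed.

Lemma unitv_eq (V : finType) (v : V) : unitv R v v = 1.
Proof. by rewrite ffunE eqxx. Qed.

Lemma vec_sumE (V I : finType) (f : I -> vec R V) w : (\sum_i f i) w = \sum_i f i w.
Proof. by rewrite sum_ffunE. Qed.

Lemma scalevE (V : finType) (a : R) (u : vec R V) w : (a *: u) w = a * u w.
Proof. by rewrite ffunE. Qed.

Lemma vec_addE (V : finType) (u h : vec R V) w : (u + h) w = u w + h w.
Proof. by rewrite ffunE. Qed.

Lemma unitv_signs (V : finType) (v w : V) : unitv R v w \in [:: 0; 1; -1 : R].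
Proof. by rewrite ffunE; case: (v == w); rewrite !inE eqxx ?orbT. Qed.

Lemma unitv_sub_signs (V : finType) (v v' w : V) : v <> v' ->
  unitv R v w - unitv R v' w \in [:: 0; 1; -1 : R].
Proof.
move=> /eqP/negPf vv'; rewrite !ffunE.
have [<-|_] := eqVneq v w; first by rewrite eq_sym vv' subr0 !inE eqxx orbT.
by case: (v' == w); rewrite ?sub0r ?oppr0 !inE eqxx ?orbT.
Qed.

Lemma unitv_sub2_signs (V : finType) (v v' v'' w : V) : v <> v' -> v <> v'' -> v' <> v'' ->
  unitv R v w - unitv R v' w - unitv R v'' w \in [:: 0; 1; -1 : R].
Proof.
move=> vv' vv'' v'v''; have [<-|/eqP vw] := eqVneq v'' w.
  by rewrite (unitv_neq vv'') (unitv_neq v'v'') unitv_eq subr0 sub0r !inE eqxx !orbT.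
by rewrite (@unitv_neq _ v'') ?subr0; [exact: unitv_sub_signs | move=> e; apply: vw; rewrite e].
Qed.

Lemma unitv_sub_sum_signs (V I : finType) (v v' w : V) (k k' : I -> V) :
  injective k -> injective k' -> v <> v' -> (forall i, v <> k i) -> (forall i, v <> k' i) ->
  (forall i, v' <> k i) -> (forall i, v' <> k' i) -> (forall i i', k i <> k' i') ->
  (unitv R v - unitv R v' - \sum_i (unitv R (k i) + unitv R (k' i))) w \in [:: 0; 1; -1 : R].
Proof.
move=> k_inj k'_inj vv' vk vk' v'k v'k' kk'.
have -> : (unitv R v - unitv R v' - \sum_i (unitv R (k i) + unitv R (k' i))) w =
    unitv R v w - unitv R v' w
    - (\sum_i 1 * unitv R (k i) w + \sum_i 1 * unitv R (k' i) w).
  rewrite !vec_subE vec_sumE -big_split; congr (_ - _); apply: eq_bigr => i _.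
  by rewrite vec_addE /= !mul1r.
have [[i wE ->]|->] := sum_unitv w k_inj; have [[i' wE' ->]|->] := sum_unitv w k'_inj.
- by case: (kk' i i'); rewrite -wE.
- rewrite wE (unitv_neq (vk i)) (unitv_neq (v'k i)) ?(addr0, subr0, sub0r).
  by rewrite !inE eqxx !orbT.
- rewrite wE' (unitv_neq (vk' i')) (unitv_neq (v'k' i')) ?(add0r, oppr0, subr0, sub0r).
  by rewrite !inE eqxx !orbT.
- by rewrite ?(addr0, subr0); exact: unitv_sub_signs.
Qed.

Lemma unitv_sub_sum2_signs (V I J : finType) (c : I -> J -> R) (v w : V)
    (k k' : I * J -> V) :
  injective k -> injective k' -> (forall p, v <> k p) -> (forall p, v <> k' p) ->
  (forall p p', k p <> k' p') -> (forall i j, c i j \in [:: 0; 1; -1]) ->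
  (unitv R v - \sum_i \sum_j c i j *: (unitv R (k (i, j)) - unitv R (k' (i, j)))) w
    \in [:: 0; 1; -1 : R].
Proof.
move=> k_inj k'_inj vk vk' kk' c_signs.
have -> : (unitv R v - \sum_i \sum_j c i j *: (unitv R (k (i, j)) - unitv R (k' (i, j)))) w =
    unitv R v w - (\sum_p c p.1 p.2 * unitv R (k p) w - \sum_p c p.1 p.2 * unitv R (k' p) w).
  rewrite vec_subE vec_sumE -sumrB; congr (_ - _).
  rewrite (eq_bigr (fun p => (fun i j => c i j *
    (unitv R (k (i, j)) w - unitv R (k' (i, j)) w)) p.1 p.2)); last first.
    by move=> [i j] _; rewrite /= mulrBr.
  rewrite -(pair_bigA _ (fun i j => c i j *
    (unitv R (k (i, j)) w - unitv R (k' (i, j)) w))) /=.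
  apply: eq_bigr => i _; rewrite vec_sumE; apply: eq_bigr => j _.
  by rewrite scalevE vec_subE.
have cN i j : - c i j \in [:: 0; 1; -1 : R].
  have := c_signs i j; rewrite !inE => /or3P[] /eqP ->.
  - by rewrite oppr0 eqxx.
  - by rewrite eqxx !orbT.
  - by rewrite opprK eqxx orbT.
have [[p wE ->]|->] := sum_unitv w k_inj; have [[p' wE' ->]|->] := sum_unitv w k'_inj.
- by case: (kk' p p'); rewrite -wE.
- by rewrite wE (unitv_neq (vk p)) subr0 sub0r.
- by rewrite wE' (unitv_neq (vk' p')) !sub0r opprK.
- by rewrite subrr subr0; exact: unitv_signs.
Qed.

Lemma symbolic_Bmat r c : symbolic (fun S => Bmat S r c).
Proof.
have xp_inj : injective (@c_xp F) by move=> i j /(congr1 (@tag _ _)) [].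
have xm_inj : injective (@c_xm F) by move=> i j /(congr1 (@tag _ _)) [].
have xpm (g : 'I_(fd F) -> R) : (\sum_j g j *: (unitv R (c_xp j) - unitv R (c_xm j))) c =
    \sum_j g j * unitv R (c_xp j) c - \sum_j g j * unitv R (c_xm j) c.
  by rewrite vec_sumE -sumrB; apply: eq_bigr => j _; rewrite scalevE vec_subE mulrBr.
case: r => [i a|l] /=.
  have E S : Bmat S (r_s a) c = unitv R (c_s a) c
      - (\sum_j sD S i a j * unitv R (c_xp j) c - \sum_j sD S i a j * unitv R (c_xm j) c)
      - sd S i a ord0 * unitv R (c_tau F) c.
    by rewrite /= !vec_subE xpm scalevE.
  apply: symbolic_ext E _.
  (* A coordinate has only one kind: the x^+, x^- and tau columns carry a single data entry up to
     sign, and the s columns carry constants. *)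
  have [[j cE sp]|sp] := sum_unitv c xp_inj; have [[j' cE' sm]|sm] := sum_unitv c xm_inj.
  - by have := congr1 (@tag _ _) (etrans (esym cE) cE').
  - apply: (symbolic_ext (g := fun S => - dentry S (PosD a j))) => [S|].
      rewrite sp sm cE !unitv_neq; first by rewrite sub0r subr0 mulr0 subr0.
        by move=> /(congr1 (@tag _ _)).
      by move=> /(congr1 (@tag _ _)).
    by apply: symbolicN; exact: symbolic_entry.
  - apply: (symbolic_entry (p := PosD a j')) => S.
    rewrite sp sm cE' !unitv_neq; first by rewrite !sub0r opprK mulr0 subr0.
      by move=> /(congr1 (@tag _ _)).
    by move=> /(congr1 (@tag _ _)).
  - have [ct|ct] := eqVneq (c_tau F) c.
      apply: (symbolic_ext (g := fun S => - dentry S (Posd a))) => [S|].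
        rewrite sp sm -ct unitv_neq; last by move=> /(congr1 (@tag _ _)).
        by rewrite ffunE eqxx mulr1 subrr sub0r oppr0 add0r.
      by apply: symbolicN; exact: symbolic_entry.
    apply: (symbolic_const (x := unitv R (c_s a) c)) => [S|]; last exact: unitv_signs.
    by rewrite sp sm (unitv_neq (elimN eqP ct)) subrr mulr0 !subr0.
have E S : Bmat S (r_E l) c =
    (\sum_j sE S l j * unitv R (c_xp j) c - \sum_j sE S l j * unitv R (c_xm j) c)
    - sf S l ord0 * unitv R (c_tau F) c.
  by rewrite /= !vec_subE xpm scalevE.
apply: symbolic_ext E _.
have [[j cE sp]|sp] := sum_unitv c xp_inj; have [[j' cE' sm]|sm] := sum_unitv c xm_inj.
- by have := congr1 (@tag _ _) (etrans (esym cE) cE').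
- apply: (symbolic_entry (p := PosE l j)) => S.
  rewrite sp sm cE unitv_neq; last by move=> /(congr1 (@tag _ _)).
  by rewrite subr0 mulr0 subr0.
- apply: (symbolic_ext (g := fun S => - dentry S (PosE l j'))) => [S|].
    rewrite sp sm cE' unitv_neq; last by move=> /(congr1 (@tag _ _)).
    by rewrite sub0r mulr0 subr0.
  by apply: symbolicN; exact: symbolic_entry.
- have [ct|ct] := eqVneq (c_tau F) c.
    apply: (symbolic_ext (g := fun S => - dentry S (Posf l))) => [S|].
      by rewrite sp sm -ct ffunE eqxx mulr1 subrr sub0r.
    by apply: symbolicN; exact: symbolic_entry.
  apply: (symbolic_const (x := 0)) => [S|]; last by rewrite inE eqxx.
  by rewrite sp sm (unitv_neq (elimN eqP ct)) subrr mulr0 subr0.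
Qed.

Lemma Rmx_signs k (r : ridx k) (a b : 'I_k) : Rmx R r a b \in [:: 0; 1; -1 : R].
Proof.
case: r => [ab|] /=; last by rewrite mxE; case: (_ == _); rewrite !inE eqxx ?orbT.
rewrite /Jmx mul_mx_diag !mxE; case: (_ && _); case: (_ && _); case: (_ == _).
all: by rewrite ?(subrr, subr0, sub0r, mul0r, mul1r, mulN1r, mulr1, opprK) !inE eqxx ?orbT.
Qed.

(** Passing through [nvar_code] turns the dependent arguments into a tagged pair, where decidable
    equality of blocks replaces dependent inversion. *)
Lemma v_v_inj (j : 'I_T) s (b : block F) :
  injective (fun p : ridx (cdim (bcone b)) * 'I_(cdim (bcone b)) => v_v j s p.1 p.2).
Proof.
move=> [r a] [r' a'] /= /(congr1 (fun v => if nvar_code v is inr (_, _, t) then Some t else None)).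
by move=> /Some_inj/eqP; rewrite eq_Tagged => /eqP.
Qed.

Lemma symbolic_neq_lhs l w : symbolic (fun S => neq_lhs S l w).
Proof.
case: l => [j c|c|j c|c|j [b a]|j [b a]] /=.
- have k_inj : injective (fun r : brow F => v_lam j r) by move=> r r' [].
  have E S : neq_lhs S (q_y j c) w = unitv R (v_y (ofst j) c) w
      - \sum_r Bmat S r c * unitv R (v_lam j r) w.
    by rewrite vec_subE vec_sumE; congr (_ - _); apply: eq_bigr => r _; rewrite scalevE.
  apply: symbolic_ext E _; have [[r wE Es]|Es] := sum_unitv w k_inj.
    apply: (symbolic_ext (g := fun S => - Bmat S r c)) => [S|].
      by rewrite Es wE unitv_neq; [rewrite sub0r | by []].
    by apply: symbolicN; exact: symbolic_Bmat.
  by apply: symbolic_const (unitv_signs (v_y (ofst j) c) w) => S; rewrite Es subr0.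
- have k_inj : injective (fun r : brow F => v_eta r) by move=> r r' [].
  have E S : neq_lhs S (q_ylast c) w = unitv R (v_y ord_max c) w
      + \sum_r Bmat S r c * unitv R (v_eta r) w.
    by rewrite vec_addE vec_sumE; congr (_ + _); apply: eq_bigr => r _; rewrite scalevE.
  apply: symbolic_ext E _; have [[r wE Es]|Es] := sum_unitv w k_inj.
    apply: symbolic_ext (symbolic_Bmat r c) => S.
    by rewrite Es wE unitv_neq; [rewrite add0r | by []].
  by apply: symbolic_const (unitv_signs (v_y ord_max c) w) => S; rewrite Es addr0.
- apply: symbolic_const => [S|]; first by [].
  by rewrite 2!vec_subE; exact: unitv_sub2_signs.
- by apply: symbolic_const (unitv_signs _ w).
- have k_inj s : injective (fun r : ridx (cdim (bcone b)) => v_v j s r a).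
    move=> r r' e.
    pose k (p : ridx (cdim (bcone b)) * 'I_(cdim (bcone b))) := v_v j s p.1 p.2.
    by have /v_v_inj[] := e : k (r, a) = k (r', a).
  apply: symbolic_const => [S|]; first by [].
  by apply: (unitv_sub_sum_signs w (k_inj true) (k_inj false)).
- apply: symbolic_const => [S|]; first by [].
  apply: (unitv_sub_sum2_signs w (@v_v_inj j true b) (@v_v_inj j false b)) => //.
  by move=> r a'; exact: Rmx_signs.
Qed.

Lemma lrows_signs (V : finType) (c : cone) (g : 'I_(cdim c) -> vec R V) a w :
  (forall b, exists v, g b = unitv R v) -> lrows g a w \in [:: 0; 1; -1].
Proof.
move=> gP; case: c g a gP => [|p] g a gP /=.
  case: ifP => _; last by rewrite ffunE inE eqxx.
  by have [v ->] := gP ord0; exact: unitv_signs.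
by have [v ->] := gP a; exact: unitv_signs.
Qed.

Lemma mksoc_template (V I Q : finType) (p : I -> nat)
    (D : forall i, 'I_(p i).+2 -> vec R V) (E : socsys R F -> Q -> vec R V) (f : Q -> R) :
  (forall i a w, D i a w \in [:: 0; 1; -1]) -> (forall l w, symbolic (fun S => E S l w)) ->
  (forall l, f l \in [:: 0; 1; -1]) ->
  exists tmpl : socsys (coef F) (mkfmt V Q p), coefs_over signs tmpl /\
    forall S, mksoc D (fun _ _ => 0) (E S) f = socmap (ceval S) tmpl.
Proof.
move=> D_signs E_symb f_signs.
have symD i a w : symbolic (fun=> D i a w) by exact: symbolic_const (fun=> erefl) (D_signs i a w).
have symf l : symbolic (fun=> f l) by exact: symbolic_const (fun=> erefl) (f_signs l).
pose tD (i : 'I_#|I|) : 'M[coef F]_((p (enum_val i)).+2, #|V|) :=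
  \matrix_(a, j) s2val (cid2 (symD (enum_val i) a (enum_val j))).
pose td (i : 'I_#|I|) : 'cV[coef F]_((p (enum_val i)).+2) := \col_a (0, None).
pose tE : 'M[coef F]_(#|Q|, #|V|) :=
  \matrix_(l, j) s2val (cid2 (E_symb (enum_val l) (enum_val j))).
pose tf : 'cV[coef F]_#|Q| := \col_l s2val (cid2 (symf (enum_val l))).
exists (@SocSys _ (mkfmt V Q p) tD td tE tf); split.
  split=> [i a j|i a|l j|l] /=; rewrite mxE.
  - by case: (cid2 _).
  - by rewrite inE eqxx.
  - by case: (cid2 _).
  - by case: (cid2 _).
move=> S; rewrite /socmap /mksoc; congr SocSys.
- apply: functional_extensionality_dep => i; apply/matrixP => a j; rewrite !mxE.
  by case: (cid2 _) => c /= _ cE; exact: (cE S).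
- apply: functional_extensionality_dep => i; apply/matrixP => a j.
  by rewrite !mxE /ceval /= rmorph0 mul0r.
- by apply/matrixP => l j; rewrite !mxE; case: (cid2 _) => c /= _ cE; exact: (cE S).
- by apply/matrixP => l j; rewrite !mxE; case: (cid2 _) => c /= _ cE; exact: (cE S).
Qed.

Lemma frakN_template : exists tmpl : socsys (coef F) (frakN_fmt F),
  coefs_over signs tmpl /\ forall S : socsys R F, frakN S = socmap (ceval S) tmpl.
Proof.
apply: mksoc_template => [i a w|l w|l].
- by apply: lrows_signs => b; exists (ncvar b).
- exact: symbolic_neq_lhs.
case: l => [j c|c|j c|c|j c|j c] /=; try by rewrite !inE eqxx.
by rewrite !ffunE; case: (_ == _); rewrite ?oppr0 !inE eqxx ?orbT.
Qed.

End Template.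

(** * Size *)

Section Size.
Local Open Scope nat_scope.

Lemma nnz_leq (R : realType) m n (A : 'M[R]_(m, n)) : nnz A <= m * n.
Proof. by apply: leq_trans (max_card _) _; rewrite card_prod !card_ord. Qed.

Lemma card_tagged_leq (I : finType) (T : I -> finType) m :
  (forall i, #|T i| <= m) -> #|{: {i : I & T i}}| <= #|I| * m.
Proof.
move=> le_m; rewrite card_tagged sumnE big_map big_enum /= -sum_nat_const.
exact: leq_sum.
Qed.

Lemma socsize_leq (R : realType) (F : socfmt) (S : socsys R F) m :
  (forall i : 'I_(fnu F), (fp i).+2 <= m) ->
  socsize S <= fd F + 2 * (fnu F * m) + fm F + fnu F * (2 * m + m * fd F) + fm F * fd F + fm F.
Proof.
move=> le_m.
have sum_le : \sum_(i < fnu F) (fp i).+2 <= fnu F * m.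
  by rewrite -[X in X * m]card_ord -sum_nat_const; exact: leq_sum.
have coef_le : \sum_(i < fnu F) ((fp i).+2 + nnz (sD S i) + nnz (sd S i)) <=
    fnu F * (2 * m + m * fd F).
  rewrite -[X in X * (2 * m + _)]card_ord -sum_nat_const; apply: leq_sum => i _.
  have := nnz_leq (sD S i); have := nnz_leq (sd S i); have := le_m i.
  have : (fp i).+2 * fd F <= m * fd F by rewrite leq_mul2r le_m orbT.
  rewrite muln1; lia.
have := nnz_leq (sE S); have := nnz_leq (sf S); rewrite muln1 /socsize.
lia.
Qed.

Section Cardinals.
Variables (R : realType) (F : socfmt) (S : socsys R F).
(** There are at most 1 + 2d + nu blocks of rank at most 2, so T + 1 is at most 3 + 4d + 2 nu; N
    also bounds the number of blocks and every block dimension. *)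
Local Notation N := (4 * socsize S + 3).

Lemma socsize_geq : fd F + \sum_(i < fnu F) (fp i).+2 + fm F <= socsize S.
Proof. rewrite /socsize; lia. Qed.

Lemma socsize_fp (i : 'I_(fnu F)) : (fp i).+2 <= socsize S.
Proof.
have := socsize_geq; rewrite (bigD1 i)//=; lia.
Qed.

Lemma fnu_leq : 2 * fnu F <= \sum_(i < fnu F) (fp i).+2.
Proof.
by rewrite mulnC -[X in X * 2]card_ord -sum_nat_const; apply: leq_sum.
Qed.

Lemma card_block : #|{: block F}| <= 1 + 2 * fd F + fnu F.
Proof.
apply: leq_trans (leq_card _ (can_inj (@block_codeK F))) _.
by rewrite !card_sum card_unit !card_ord; lia.
Qed.

Lemma card_block_leq : #|{: block F}| <= N.
Proof. by have := card_block; have := socsize_geq; have := fnu_leq; lia. Qed.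

Lemma rankC_leq : (rankC F).+1 <= N.
Proof.
have : rankC F <= #|{: block F}| * 2.
  by rewrite -sum_nat_const; apply: leq_sum => b _; case: (bcone b).
by have := card_block; have := socsize_geq; have := fnu_leq; lia.
Qed.

Lemma cdim_leq (b : block F) : cdim (bcone b) <= (socsize S).+1.
Proof. by case: b => //= i; have := socsize_fp i; lia. Qed.

Lemma card_coord_leq : #|{: Defs.coord F}| <= N ^ 2.
Proof.
apply: leq_trans (card_tagged_leq (m := N) _) _ => [b|]; last first.
  by rewrite expnS expn1 leq_mul2r card_block_leq orbT.
by rewrite card_ord; have := cdim_leq b; lia.
Qed.

Lemma card_brow_leq : #|{: brow F}| <= N ^ 2.
Proof.
apply: leq_trans (leq_card _ (can_inj (@brow_codeK F))) _.
rewrite card_sum card_ord.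
apply: leq_trans (leq_add (card_tagged_leq (m := socsize S) _) (leqnn _)) _ => [i|].
  by rewrite card_ord; exact: socsize_fp.
rewrite card_ord.
have [le_nu le_m] : fnu F <= socsize S /\ fm F <= socsize S.
  by have := socsize_geq; have := fnu_leq; lia.
have := leq_mul le_nu (leqnn (socsize S)); rewrite expnS expn1; lia.
Qed.

Lemma card_ridx_leq (b : block F) : #|ridx (cdim (bcone b))| <= N ^ 2.
Proof.
rewrite card_option card_sig.
apply: (@leq_trans (cdim (bcone b) * cdim (bcone b)).+1).
  by rewrite ltnS; apply: leq_trans (max_card _) _; rewrite card_prod card_ord.
have := leq_mul (cdim_leq b) (cdim_leq b); rewrite expnS expn1; lia.
Qed.

(** The vectors [v_v] dominate: steps, signs, blocks, matrix indices and coordinates give 2 N^5.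
    Each of the six other families has at most N^5 members. *)
Lemma card_nvar_leq : #|{: nvar F}| <= 8 * N ^ 5.
Proof.
apply: leq_trans (leq_card _ (can_inj (@nvar_codeK F))) _.
rewrite !card_sum !card_prod !card_ord card_bool.
have vv : #|{: {b : block F & (ridx (cdim (bcone b)) * 'I_(cdim (bcone b)))%type}}| <= N * N ^ 3.
  apply: leq_trans (card_tagged_leq (m := N ^ 3) _) _ => [b|]; last first.
    by rewrite leq_mul2r card_block_leq orbT.
  rewrite card_prod card_ord expnSr; apply: leq_mul; first exact: card_ridx_leq.
  by have := cdim_leq b; lia.
have T1 := rankC_leq; have T0 := ltnW T1.
have NN k : k <= 5 -> N ^ k <= N ^ 5 by move=> k5; apply: leq_pexp2l => //; lia.
have hb := card_brow_leq; have hc := card_coord_leq.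
apply: leq_trans (leq_add (leq_add (leq_add (leq_add (leq_add (leq_add hb (leq_mul T0 hb))
  (leq_mul T1 hc)) (leq_mul T1 hc)) (leq_mul T1 hc)) (leq_mul T0 hc))
  (leq_mul (leq_mul T0 (leqnn 2)) vv)) _.
rewrite -!expnS; have := NN 2 isT; have := NN 3 isT.
have -> : N * 2 * N ^ 4 = 2 * N ^ 5 by rewrite [N * 2]mulnC -mulnA -expnS.
lia.
Qed.

Lemma card_ncone_leq : #|{: ncone F}| <= 4 * N ^ 4.
Proof.
apply: leq_trans (leq_card _ (can_inj (@ncone_codeK F))) _.
rewrite !card_sum !card_prod !card_ord card_bool.
have vv : #|{: {b : block F & (ridx (cdim (bcone b)) : Type)}}| <= N * N ^ 2.
  apply: leq_trans (card_tagged_leq (m := N ^ 2) card_ridx_leq) _.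
  by rewrite leq_mul2r card_block_leq orbT.
have T1 := rankC_leq; have T0 := ltnW T1.
have NN : N * N <= N ^ 4 by rewrite -[N * N]/(N ^ 2); apply: leq_pexp2l => //; lia.
have hb := card_block_leq.
apply: leq_trans (leq_add (leq_add (leq_mul T1 hb) (leq_mul T0 hb))
  (leq_mul (leq_mul T0 (leqnn 2)) vv)) _.
have -> : N * 2 * (N * N ^ 2) = 2 * N ^ 4 by rewrite [N * 2]mulnC -mulnA -!expnS.
lia.
Qed.

Lemma card_neqn_leq : #|{: neqn F}| <= 6 * N ^ 3.
Proof.
apply: leq_trans (leq_card _ (can_inj (@neqn_codeK F))) _.
rewrite !card_sum !card_prod !card_ord.
have T1 := rankC_leq; have T0 := ltnW T1.
have NN : N ^ 2 <= N ^ 3 by apply: leq_pexp2l => //; lia.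
have hc := card_coord_leq.
apply: leq_trans (leq_add (leq_add (leq_add (leq_add (leq_add (leq_mul T0 hc) hc)
  (leq_mul T1 hc)) hc) (leq_mul T0 hc)) (leq_mul T0 hc)) _.
rewrite -!expnS; lia.
Qed.

Lemma socsize_frakN_leq : socsize (frakN S) <= 116 * N ^ 10.
Proof.
apply: leq_trans (socsize_leq (m := N) _ _) _ => [i|].
  rewrite /= /ncpre; case: (nblock _) => [|j|j|i'] /=; try lia.
  by have := socsize_fp i'; lia.
(* The summands contribute 8 + 8 + 6 + 8 + 32 + 48 + 6 = 116. The degree 10 comes from the
   coefficients of the cone rows: cones times dimension times variables. *)
suff bound x a b q : 0 < x -> a <= 8 * x ^ 5 -> b <= 4 * x ^ 4 -> q <= 6 * x ^ 3 ->
    a + 2 * (b * x) + q + b * (2 * x + x * a) + q * a + q <= 116 * x ^ 10.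
  by apply: bound card_nvar_leq card_ncone_leq card_neqn_leq; rewrite addn3.
move=> x0 A B Q.
have xN k : k <= 10 -> x ^ k <= x ^ 10 by exact: leq_pexp2l.
have BN := leq_mul B (leqnn x); have BNA := leq_mul BN A; have QA := leq_mul Q A.
have E1 : 4 * x ^ 4 * x = 4 * x ^ 5 by rewrite -mulnA -expnSr.
have E2 : 4 * x ^ 5 * (8 * x ^ 5) = 32 * x ^ 10 by rewrite mulnACA -expnD.
have E3 : 6 * x ^ 3 * (8 * x ^ 5) = 48 * x ^ 8 by rewrite mulnACA -expnD.
rewrite E1 in BN BNA; rewrite E2 in BNA; rewrite E3 in QA.
have := xN 5 isT; have := xN 3 isT; have := xN 8 isT.
rewrite mulnDr [b * (2 * x)]mulnCA [b * (x * a)]mulnA.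
lia.
Qed.

End Cardinals.
End Size.

Theorem corollary3p7 (R : realType) :
  exists (P : {poly nat}) (K : seq rat), forall F : socfmt,
    (exists tmpl : socsys (coef F) (frakN_fmt F),
       coefs_over K tmpl /\
       forall S : socsys R F, frakN S = socmap (ceval S) tmpl) /\
    (forall S : socsys R F,
       [/\ (socsize (frakN S) <= P.[socsize S])%N,
           feasible (frakN S) <->
             (exists (eta : vec R (brow F)) (lam : 'I_(rankC F) -> vec R (brow F))
                     (y q z : 'I_(rankC F).+1 -> ambient R F),
                frakN_sol S eta lam y q z),
           feasible (frakN S) <->
             (forall h : ambient R F, Hset S h -> h (c_tau F) = 0)
         & feasible (frakN S) <-> solset S = set0%classic]).
Proof.
exists (116%:P * (4%:P * 'X + 3%:P) ^+ 10), signs => F.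
split=> [|S]; first exact: frakN_template.
have tauP : feasible (frakN S) <-> (forall h : ambient R F, Hset S h -> h (c_tau F) = 0).
  split=> [/frakN_feasibleP[eta [lam [y [q [z sol]]]]] h Hh|tau0].
    exact: frakN_sol_sound sol Hh.
  by apply/frakN_feasibleP; exact: frakN_sol_complete.
split=> //; [|exact: frakN_feasibleP|by rewrite -homogenization].
by rewrite hornerM horner_exp hornerD hornerM !hornerC hornerX; exact: socsize_frakN_leq.
Qed.
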